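(* Consider the Saint-Venant-Maxwell (SVM) system described in the context, written for the conserved variables $(H,\ H\boldsymbol{U},\ H\boldsymbol{F}_h,\ HA_{cc}^{1/4},\ H\boldsymbol{A}_h^{-2})$, i.e. the system of conservation laws \begin{align*} & \partial_t H + \operatorname{div}( H \boldsymbol{U} ) = 0, \\ & \partial_t (H\boldsymbol{F}_h) + \operatorname{div}( H \boldsymbol{U}\otimes\boldsymbol{F}_h-H\boldsymbol{F}_h\otimes\boldsymbol{U} ) = 0, \\ & \partial_t(H\boldsymbol{U}) + \operatorname{div}\bigl(H\boldsymbol{U}\otimes\boldsymbol{U} + (\tfrac{g}{2}H^2 + GH^3 A_{cc})\boldsymbol{I} - GH\boldsymbol{F}_h\boldsymbol{A}_h\boldsymbol{F}_h^T \bigr) = -KH\boldsymbol{U}, \\ & \partial_t (H\boldsymbol{A}_h^{-2}) + \operatorname{div}( H \boldsymbol{U}\otimes\boldsymbol{A}_h^{-2} ) = H\boldsymbol{A}_h^{-1}\bigl(2\boldsymbol{I}-\boldsymbol{A}_h^{-1}\boldsymbol{F}_h^{-1}\boldsymbol{F}_h^{-T}-\boldsymbol{F}_h^{-1}\boldsymbol{F}_h^{-T}\boldsymbol{A}_h^{-1}\bigr)\boldsymbol{A}_h^{-1}/\lambda, \\ & \partial_t (HA_{cc}^{1/4}) + \operatorname{div}( H \boldsymbol{U} A_{cc}^{1/4} ) = H\bigl(H^{-2}A_{cc}^{-3/4}-A_{cc}^{1/4}\bigr)/(4\lambda), \end{align*} where $\boldsymbol{A}_h^{-1}$ is the square-root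 matrix of $\boldsymbol{A}_h^{-2}$. On neglecting the source terms (the right-hand sides), this system is equipped with the mathematical entropy $H\tilde E$, where $$ \tilde E = \tfrac12\bigl(|\boldsymbol{U}|^2+gH\bigr) + \tfrac{G}{2} \bigl( \operatorname{tr}(\boldsymbol{F}_h\boldsymbol{A}_h\boldsymbol{F}_h^T) + H^2 A_{cc} \bigr). $$ It is therefore symmetric hyperbolic on the convex admissibility domain $$ \mathcal{A} := \{H>0,\ \boldsymbol{A}_h^{-1}=\boldsymbol{A}_h^{-T}>0,\ A_{cc}^{-1}>0\}. $$
   Context: The unknowns are functions of time $t$ and of $(x,y)\in\mathbb{R}^2$: the scalar $H>0$ (water depth), the velocity $\boldsymbol{U}=(U^x,U^y)\in\mathbb{R}^2$, the horizontal deformation gradient $\boldsymbol{F}_h=(F^i_\alpha)$ ($2\times2$ matrix, $i\in\{x,y\}$ geometric index, $\alpha\in\{a,b\}$ material index), a symmetric positive definite $2\times2$ matrix $\boldsymbol{A}_h=(A_{\alpha\beta})$ and a scalar $A_{cc}>0$. The constants are $g>0$ (gravity), $G>0$ (elasticity modulus), $\lambda>0$ (relaxation time), $K\ge0$ (friction). $\boldsymbol{I}$ is the identity matrix; $|\boldsymbol{F}_h|$ denotes the determinant of $\boldsymbol{F}_h$. The SVM system consists of the first three equations of the claim together with $$ \partial_t (H\boldsymbol{A}_h) + \operatorname{div}( H \boldsymbol{U}\otimes\boldsymbol{A}_h ) = H(\boldsymbol{F}_h^{-1}\boldsymbol{F}_h^{-T}-\boldsymbol{A}_h)/\lambda,\qquad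 \partial_t (HA_{cc}) + \operatorname{div}( H \boldsymbol{U} A_{cc} ) = H(H^{-2}-A_{cc})/\lambda, $$ which for smooth solutions are equivalent to the last two equations of the claim. In components (summation over repeated $j$), the $\boldsymbol{F}_h$ equation reads $\partial_t (HF^i_\alpha) + \partial_j( H U^j F^i_\alpha - H F^j_\alpha U^i ) = 0$; similarly $\operatorname{div}(H\boldsymbol{U}\otimes\boldsymbol{M})$ has components $\partial_j(HU^jM_{\alpha\beta})$. Since $\boldsymbol{F}_h$ is a deformation gradient of an incompressible continuum, states and solutions are understood to satisfy $H|\boldsymbol{F}_h|=1$ and Piola's identities $\partial_j(HF^j_\alpha)=0$ for $\alpha\in\{a,b\}$; these relations are involutions, i.e. they hold at all times if they hold initially. A mathematical entropy of a system of conservation laws is a strictly convex function of the conserved variables which, for smooth solutions, satisfies an additional (companion) conservation law. Here the companion law (without source) is $$ \partial_t(H\tilde E) + \operatorname{div}\bigl(H\tilde E\,\boldsymbol{U}+(\tfrac{g}{2}H^2+GH^3A_{cc})\boldsymbol{U}-GH\boldsymbol{F}_h\boldsymbol{A}_h\boldsymbol{F}_h^T\boldsymbol{U}\bigr) = 0 . $$ Symmetric hyperbolic means that the quasilinear first-order system can be put in symmetric form with a symmetric positive definite matrix multiplying the time derivative. *)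

(* Defs.v *)
From mathcomp Require Import all_boot all_order all_algebra.
From mathcomp Require Import all_classical all_reals all_analysis.
Import Order.TTheory GRing.Theory Num.Theory.
Import numFieldNormedType.Exports.

Set Implicit Arguments.
Unset Strict Implicit.
Unset Printing Implicit Defensive.

Local Open Scope classical_set_scope.
Local Open Scope ring_scope.

Section Generic.
Context {R : realType}.

Definition posdefmx n (M : 'M[R]_n) : Prop :=
  forall v : 'cV[R]_n, v != 0 -> 0 < (v^T *m M *m v) 0 0.

(* The symmetric positive definite square root; the junk value 0, which is not
   positive definite, is taken when there is none. *)
Definition sqrtmx n (M : 'M[R]_n) : 'M[R]_n :=
  xget 0 [set S | [/\ S^T = S, posdefmx S & S *m S = M]].

(* f lies strictly below every chord of D that issues from x. *)
Definition strictly_convex_at (V : lmodType R) (D : set V) (f : V -> R) (x : V)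
    : Prop :=
  forall (y : V) (t : R), D y -> y != x -> 0 < t < 1 ->
    f (t *: x + (1 - t) *: y) < t * f x + (1 - t) * f y.

(* Points of space-time are rows (t, x, y). *)
Definition spacetime := 'rV[R]_3.

Definition dir_t : spacetime := delta_mx 0 0.
Definition dir_x (j : 'I_2) : spacetime := delta_mx 0 (lift 0 j).

Definition C1_on (V : normedModType R) (O : set spacetime)
    (u : spacetime -> V) : Prop :=
  forall p, O p -> differentiable u p /\
    forall k : 'I_3, {for p, continuous ('D_(delta_mx 0 k) u)}.

(* d_t u + d_x phi_x + d_y phi_y = s on O; since 'D_v is a total operator, the
   existence of the derivatives is required too. *)
Definition balance_law (V : normedModType R) (O : set spacetime)
    (u : spacetime -> V) (phi : 'I_2 -> spacetime -> V) (s : spacetime -> V)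
    : Prop :=
  forall p, O p ->
    [/\ derivable u p dir_t,
        forall j, derivable (phi j) p (dir_x j)
      & 'D_dir_t u p + \sum_(j < 2) 'D_(dir_x j) (phi j) p = s p].

End Generic.
Arguments spacetime R : clear implicits.

Section SVM.
Context {R : realType}.

(* The conserved variables (H, HU, HF_h, HA_cc^{1/4}, HA_h^{-2}) as a vector of
   R^11: the symmetric matrix Y contributes its entries aa, ab, bb. *)
Definition cvars (h : R) (m : 'cV[R]_2) (M : 'M[R]_2) (c : R) (Y : 'M[R]_2)
    : 'rV[R]_11 :=
  \row_(k < 11) nth 0 [:: h; m 0 0; m 1 0; M 0 0; M 0 1; M 1 0; M 1 1; c;
                          Y 0 0; Y 0 1; Y 1 1] k.

Implicit Types q : 'rV[R]_11.

Definition cH q : R := q 0 (inord 0).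
Definition cHU q : 'cV[R]_2 := \col_(i < 2) q 0 (inord (1 + i)).
Definition cHF q : 'M[R]_2 :=
  \matrix_(i < 2, a < 2) q 0 (inord (3 + (i.*2 + a))).
Definition cHAcc14 q : R := q 0 (inord 7).
Definition cHAm2 q : 'M[R]_2 := \matrix_(a < 2, b < 2) q 0 (inord (8 + (a + b))).

Definition vU q : 'cV[R]_2 := (cH q)^-1 *: cHU q.
Definition vF q : 'M[R]_2 := (cH q)^-1 *: cHF q.
Definition vAcc14 q : R := cHAcc14 q / cH q.
Definition vAcc q : R := vAcc14 q ^+ 4.
Definition vAm2 q : 'M[R]_2 := (cH q)^-1 *: cHAm2 q.
Definition vAm1 q : 'M[R]_2 := sqrtmx (vAm2 q).
Definition vA q : 'M[R]_2 := invmx (vAm1 q).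

(* A_cc^{1/4} denotes the nonnegative fourth root, which vAcc cannot see. *)
Definition admissible : set 'rV[R]_11 :=
  [set q | [/\ 0 < cH q, (vAm1 q)^T = vAm1 q, posdefmx (vAm1 q),
               0 <= vAcc14 q & 0 < (vAcc q)^-1]].

Definition state : set 'rV[R]_11 :=
  [set q | admissible q /\ cH q * \det (vF q) = 1].

Variables g G lambda K : R.

Definition pressure_stress q : 'M[R]_2 :=
  (g / 2 * cH q ^+ 2 + G * cH q ^+ 3 * vAcc q)%:M
  - (G * cH q) *: (vF q *m vA q *m (vF q)^T).

Definition flux (j : 'I_2) q : 'rV[R]_11 :=
  cvars (cH q * vU q j 0)
        ((cH q * vU q j 0) *: vU q + col j (pressure_stress q))
        (\matrix_(i < 2, a < 2) (cH q * vU q j 0 * vF q i a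
                                 - cH q * vF q j a * vU q i 0))
        (cH q * vU q j 0 * vAcc14 q)
        ((cH q * vU q j 0) *: vAm2 q).

Definition source q : 'rV[R]_11 :=
  let C := invmx (vF q) *m (invmx (vF q))^T in
  cvars 0
        (- (K * cH q) *: vU q)
        0
        (cH q * (cH q ^- 2 * vAcc14 q ^- 3 - vAcc14 q) / (4 * lambda))
        ((cH q / lambda) *:
           (vAm1 q *m (2%:M - vAm1 q *m C - C *m vAm1 q) *m vAm1 q)).

Definition entropy q : R :=
  cH q * ((\sum_(i < 2) vU q i 0 ^+ 2 + g * cH q) / 2
          + G / 2 * (\tr (vF q *m vA q *m (vF q)^T) + cH q ^+ 2 * vAcc q)).

Definition entropy_flux (j : 'I_2) q : R :=
  entropy q * vU q j 0 + (pressure_stress q *m vU q) j 0.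

(* Smooth fields of states on the space-time domain O, subject to H|F_h| = 1
   and to the two Piola identities. *)
Definition smooth_field (O : set (spacetime R)) (Q : spacetime R -> 'rV[R]_11)
    : Prop :=
  [/\ open O, C1_on O Q, (forall p, O p -> state (Q p))
    & forall p, O p -> forall a : 'I_2,
        \sum_(j < 2) 'D_(dir_x j) (fun z => cHF (Q z) j a : R^o) p = 0].

(* Strictness is asked at states only: where F_h = 0, entropy does not depend on
   A_h, so it is convex but not strictly convex on the whole admissible set. *)
Definition mathematical_entropy (eta : 'rV[R]_11 -> R)
    (psi : 'I_2 -> 'rV[R]_11 -> R) : Prop :=
  [/\ convex_function admissible eta,
      forall q, state q -> strictly_convex_at admissible eta q
    & forall O Q, smooth_field O Q ->
        balance_law O Q (fun j => flux j \o Q) (fun=> 0) ->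
        balance_law (V := R^o) O (eta \o Q) (fun j => psi j \o Q) (fun=> 0)].

(* S0 d_t Q + S_x d_x Q + S_y d_y Q = S0 source, equivalent to the system on
   smooth fields; the Piola identities enter the matrices S_x and S_y. *)
Definition symmetric_hyperbolic : Prop :=
  exists (S0 : 'rV[R]_11 -> 'M[R]_11) (S : 'I_2 -> 'rV[R]_11 -> 'M[R]_11),
    [/\ {within admissible, continuous S0},
        forall j, {within admissible, continuous (S j)},
        forall q, admissible q -> (S0 q)^T = S0 q /\ posdefmx (S0 q),
        forall j q, admissible q -> (S j q)^T = S j q
      & forall O Q, smooth_field O Q ->
          balance_law O Q (fun j => flux j \o Q) (source \o Q) <->
          forall p, O p ->
            S0 (Q p) *m ('D_dir_t Q p)^T
            + \sum_(j < 2) S j (Q p) *m ('D_(dir_x j) Q p)^T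
            = S0 (Q p) *m (source (Q p))^T].

End SVM.
Arguments admissible R : clear implicits.

(* Main.v *)
Require Import Defs.
From HB Require Import structures.
From mathcomp Require Import all_boot all_order all_algebra.
From mathcomp Require Import all_classical all_reals all_analysis.
From mathcomp Require Import ring.
Import Order.TTheory GRing.Theory Num.Theory.
Import numFieldNormedType.Exports.

Set Implicit Arguments.
Unset Strict Implicit.
Unset Printing Implicit Defensive.

Local Open Scope classical_set_scope.
Local Open Scope ring_scope.

(* Write [F, S, A] for [F_h, A_h^{-1}, A_h], and [h, c] for [H, A_cc^{1/4}].

   Convexity.  In [H tr (F A F^T)] one has [H F = M] and [A = h P^{-1}] with
   [P = h S = (h N)^{1/2}], [N = H A_h^{-2}], so this term is [tr (M P^{-1} M^T)]:
   jointly convex in [(M, P)] and decreasing in [P], while [P] is an operator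
   concave function of [(h, N)].  Both facts are used with explicit defects, which
   give entropy = (affine function, tangent at z) + (sum of squares); at a state
   [det F <> 0] and the sum of squares vanishes only at [z].

   Companion law.  Along the divergence of the flux, Piola's identities turn the
   system into [D_t F^i = F^j d_j U^i], [D_t A = 0], [D_t c = 0], after which the
   law is the chain rule.

   Symmetric form.  In the variables [(p, U, Z = F A, c, A_h^{-2})], with [p] the
   pressure, the quasilinear system reads
     [(1 / (h p_h)) D_t p + div U = 0],
     [h D_t U^i + d_i p - G h F^j_b d_j Z^i_b = 0],
     [G h (D_t Z^i S)_b - G h F^j_b d_j U^i = 0],
     [D_t c = 0], [D_t A_h^{-2} = 0],
   which is symmetric; the symmetrizer is its pull-back to the conserved
   variables. *)

(** * Square roots of symmetric positive definite 2x2 matrices *)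

Section Matrix2.
Context {R : realType}.
Implicit Types (A B S T Y : 'M[R]_2).

Lemma ord2P (i : 'I_2) : i = 0 \/ i = 1.
Proof. by case: i => [[|[|//]] ?]; [left | right]; apply/val_inj. Qed.

Lemma sum2 (V : nmodType) (F : 'I_2 -> V) : \sum_(i < 2) F i = F 0 + F 1.
Proof. by rewrite big_ord_recr big_ord1 /=; congr (F _ + F _); apply/val_inj. Qed.

Lemma mulmx2 m n (M : 'M[R]_(m, 2)) (N : 'M[R]_(2, n)) i j :
  (M *m N) i j = M i 0 * N 0 j + M i 1 * N 1 j.
Proof. by rewrite mxE sum2. Qed.

Lemma matrix2P A B : A 0 0 = B 0 0 -> A 0 1 = B 0 1 -> A 1 0 = B 1 0 ->
  A 1 1 = B 1 1 -> A = B.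
Proof.
by move=> ? ? ? ?; apply/matrixP => i j; case: (ord2P i) (ord2P j) => -> [] ->.
Qed.

Lemma det2 A : \det A = A 0 0 * A 1 1 - A 0 1 * A 1 0.
Proof.
rewrite (expand_det_row _ 0) sum2 /cofactor !det_mx11 !mxE /= expr0 expr1.
have -> : lift 0 0 = 1 :> 'I_2 by apply/val_inj.
have -> : lift 1 0 = 0 :> 'I_2 by apply/val_inj.
by ring.
Qed.

Lemma tr2 A : \tr A = A 0 0 + A 1 1.
Proof. by rewrite /mxtrace sum2. Qed.

Lemma sym2 S : S^T = S -> S 1 0 = S 0 1.
Proof. by move=> h; rewrite -{1}h mxE. Qed.

Lemma quadform2 S (v : 'cV[R]_2) : (v^T *m S *m v) 0 0 =
  S 0 0 * v 0 0 ^+ 2 + (S 0 1 + S 1 0) * (v 0 0 * v 1 0) + S 1 1 * v 1 0 ^+ 2.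
Proof. by rewrite !mulmx2 !mxE; ring. Qed.

(** Sylvester's criterion. Two test vectors give one direction, completion of the square the
    other. *)
Lemma posdef2P S : S^T = S -> posdefmx S <-> 0 < S 0 0 /\ 0 < \det S.
Proof.
move=> symS; rewrite det2 (sym2 symS); split=> [pS | [a0 d0] v v0].
  have a0 : 0 < S 0 0.
    have := pS (\col_i (i == 0)%:R); rewrite quadform2 !mxE /= => H.
    have := H _; rewrite !expr2 !(mulr0, mulr1, addr0); apply.
    by apply/eqP => /matrixP/(_ 0 0); rewrite !mxE /= => /eqP; rewrite oner_eq0.
  (* This vector makes the quadratic form equal to [S 0 0 * \det S]. *)
  split=> //; pose v : 'cV[R]_2 := \col_i (if i == 0 then - S 0 1 else S 0 0).
  have /pS : v != 0.
    apply/eqP => /matrixP/(_ 1 0); rewrite !mxE /= => H.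
    by rewrite H ltxx in a0.
  rewrite quadform2 !mxE /= (sym2 symS).
  rewrite [X in 0 < X](_ : _ = S 0 0 * (S 0 0 * S 1 1 - S 0 1 * S 0 1)); last by ring.
  by rewrite pmulr_rgt0.
(* Multiplied by [S 0 0 > 0], the form becomes a square plus [\det S] times the square of
   [v 1 0]. *)
rewrite quadform2 (sym2 symS) -(pmulr_rgt0 _ a0).
rewrite [X in 0 < X](_ : _ = (S 0 0 * v 0 0 + S 0 1 * v 1 0) ^+ 2
   + (S 0 0 * S 1 1 - S 0 1 * S 0 1) * v 1 0 ^+ 2); last by ring.
have [v1|v1] := eqVneq (v 1 0) 0.
  have v00 : v 0 0 != 0.
    apply: contraNneq v0 => v00; apply/eqP/colP => i.
    by case: (ord2P i) => ->; rewrite mxE.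
  rewrite v1 expr0n /= !mulr0 !addr0 exprn_even_gt0 //=.
  exact: mulf_neq0 (lt0r_neq0 a0) v00.
by rewrite ltr_wpDl ?sqr_ge0 // mulr_gt0 // exprn_even_gt0.
Qed.

(* From the Cayley-Hamilton identity [S^2 - (tr S) S + det S = 0], where
   [det S = (det Y)^{1/2}] and [(tr S)^2 = tr Y + 2 det S]. *)
Definition sqrt2 Y : 'M[R]_2 :=
  (Num.sqrt (\tr Y + 2 * Num.sqrt (\det Y)))^-1 *: (Y + (Num.sqrt (\det Y))%:M).

(** Uniqueness of the positive definite root: the closed formula recovers any such root from its
    square. This lets the choice made in [sqrtmx] be computed. *)
Lemma sqrt2_unique S : S^T = S -> posdefmx S -> sqrt2 (S *m S) = S.
Proof.
move=> symS /(posdef2P symS) [a0 d0]; rewrite /sqrt2 det_mulmx -expr2.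
rewrite sqrtr_sqr gtr0_norm //.
have c0 : 0 < S 1 1.
  rewrite -(pmulr_rgt0 _ a0); move: d0; rewrite det2 (sym2 symS) => d0.
  by rewrite (lt_le_trans d0) // gerBl -expr2 sqr_ge0.
have -> : \tr (S *m S) + 2 * \det S = (\tr S) ^+ 2.
  by rewrite !tr2 !mulmx2 det2 (sym2 symS); ring.
have t0 : 0 < \tr S by rewrite tr2 addr_gt0.
rewrite sqrtr_sqr gtr0_norm //.
have t1 : S 0 0 + S 1 1 != 0 by rewrite -tr2 gt_eqF.
by apply: matrix2P; rewrite !mxE sum2 det2 tr2 (sym2 symS) /=; field.
Qed.

Lemma sqrt2P Y : Y^T = Y -> posdefmx Y ->
  [/\ (sqrt2 Y)^T = sqrt2 Y, posdefmx (sqrt2 Y) & sqrt2 Y *m sqrt2 Y = Y].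
Proof.
move=> symY /[dup] pY /(posdef2P symY) [a0 D0].
have c0 : 0 < Y 1 1.
  rewrite -(pmulr_rgt0 _ a0); move: D0; rewrite det2 (sym2 symY) => d0.
  by rewrite (lt_le_trans d0) // gerBl -expr2 sqr_ge0.
rewrite /sqrt2; set d := Num.sqrt (\det Y).
have d0 : 0 < d by rewrite sqrtr_gt0.
have dd : d ^+ 2 = \det Y by rewrite sqr_sqrtr // ltW.
set t := Num.sqrt _.
have tt : t ^+ 2 = \tr Y + 2 * d.
  by rewrite sqr_sqrtr // tr2 !addr_ge0 // ?mulr_ge0 // ltW.
have t0 : 0 < t by rewrite sqrtr_gt0 tr2 !addr_gt0 // mulr_gt0.
have sS : (t^-1 *: (Y + d%:M))^T = t^-1 *: (Y + d%:M).
  by rewrite linearZ linearD /= symY tr_scalar_mx.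
move: dd tt; rewrite det2 tr2 (sym2 symY) => dd tt.
have tn : t != 0 by rewrite gt_eqF.
split => //.
  apply/posdef2P => //; split.
    by rewrite !mxE /= mulr_gt0 ?invr_gt0 // addr_gt0.
  rewrite det2 !mxE /= !(mulr1n, mulr0n, addr0) (sym2 symY).
  rewrite [X in 0 < X](_ : _ = (Y 0 0 * Y 1 1 - Y 0 1 * Y 0 1
    + d * (Y 0 0 + Y 1 1) + d ^+ 2) / t ^+ 2); last by field.
  by rewrite -dd divr_gt0 ?exprn_gt0 // !addr_gt0 ?mulr_gt0 ?exprn_gt0 ?addr_gt0.
(* The entries of [(Y + d)^2 = t^2 Y], which is Cayley-Hamilton for [Y] with [d^2 = det Y] and
   [t^2 = tr Y + 2 d]. *)
have E : (Y 0 0 + d) ^+ 2 + Y 0 1 ^+ 2 = Y 0 0 * t ^+ 2 /\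
  (Y 1 1 + d) ^+ 2 + Y 0 1 ^+ 2 = Y 1 1 * t ^+ 2 /\
  Y 0 1 * (Y 0 0 + d) + Y 0 1 * (Y 1 1 + d) = Y 0 1 * t ^+ 2.
  rewrite tt; split; [|split]; last by ring.
    by rewrite sqrrD dd; ring.
  by rewrite sqrrD dd; ring.
case: E => E0 [E1 E2].
apply: matrix2P; rewrite -scalemxAl -scalemxAr scalerA -expr2 mxE mulmx2 !mxE /=
  ?(mulr1n, mulr0n, addr0) ?(sym2 symY) exprVn; apply: (canLR (mulKf _));
  rewrite ?expf_neq0 //.
- by rewrite [RHS]mulrC -E0; ring.
- by rewrite [RHS]mulrC -E2; ring.
- by rewrite [RHS]mulrC -E2; ring.
- by rewrite [RHS]mulrC -E1; ring.
Qed.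

Lemma sqrtmxE Y : Y^T = Y -> posdefmx Y -> sqrtmx Y = sqrt2 Y.
Proof.
move=> symY pY; have PS := sqrt2P symY pY.
have := @xgetPex _ 0 [set S | [/\ S^T = S, posdefmx S & S *m S = Y]].
case; first by exists (sqrt2 Y).
by move=> symS pS SY; rewrite -[in RHS]SY sqrt2_unique.
Qed.

(** Positive definiteness of the value rules out the junk value 0, as a test on the constant vector
    1 shows; so a root exists and was chosen. *)
Lemma posdef_sqrtmx Y : posdefmx (sqrtmx Y) ->
  (sqrtmx Y)^T = sqrtmx Y /\ sqrtmx Y *m sqrtmx Y = Y.
Proof.
rewrite /sqrtmx; case: xgetP => [S _ [] // | _ /(_ (const_mx 1))].
rewrite mulmx0 mul0mx mxE ltxx => H; exfalso; suff: false by [].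
by apply: H; apply/eqP => /matrixP/(_ 0 0); rewrite !mxE => /eqP; rewrite oner_eq0.
Qed.

Lemma posdef_sqr S : S^T = S -> posdefmx S -> posdefmx (S *m S).
Proof.
move=> symS pS; have [a0 d0] := (posdef2P symS).1 pS.
apply/posdef2P; first by rewrite trmx_mul symS.
rewrite det_mulmx -expr2 exprn_gt0 //; split=> //.
by rewrite mulmx2 (sym2 symS) ltr_wpDr -?expr2 ?sqr_ge0 // exprn_gt0.
Qed.

Lemma posdef_sqrtmxP Y : Y^T = Y -> posdefmx (sqrtmx Y) <-> posdefmx Y.
Proof.
move=> symY; split=> [pS | pY]; last by rewrite sqrtmxE //; case: (sqrt2P symY pY).
by have [symS SS] := posdef_sqrtmx pS; rewrite -SS; exact: posdef_sqr.
Qed.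

End Matrix2.

(** * Block coordinates of the conserved variables *)

Section Coordinates.
Context {R : realType}.
Implicit Types (q d : 'rV[R]_11).

Lemma cvarsK q : cvars (cH q) (cHU q) (cHF q) (cHAcc14 q) (cHAm2 q) = q.
Proof.
apply/rowP => k; rewrite !mxE.
by case: k => [[|[|[|[|[|[|[|[|[|[|[|//]]]]]]]]]]] lk] /=;
  congr (q 0 _); apply/val_inj; rewrite /= inordK.
Qed.

Lemma blocks_eq q d : cH q = cH d -> cHU q = cHU d -> cHF q = cHF d ->
  cHAcc14 q = cHAcc14 d -> cHAm2 q = cHAm2 d -> q = d.
Proof. by move=> ? ? ? ? ?; rewrite -(cvarsK q) -(cvarsK d); congr cvars. Qed.

Lemma cHAm2_sym q : (cHAm2 q)^T = cHAm2 q.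
Proof. by apply/matrixP => a b; rewrite !mxE [(b + a)%N]addnC. Qed.

Section Projections.
Variables (h : R) (m : 'cV[R]_2) (M : 'M[R]_2) (c : R) (Y : 'M[R]_2).

Lemma cH_cvars : cH (cvars h m M c Y) = h.
Proof. by rewrite /cH mxE inordK. Qed.

Lemma cHU_cvars : cHU (cvars h m M c Y) = m.
Proof. by apply/colP => i; rewrite !mxE; case: (ord2P i) => ->; rewrite inordK. Qed.

Lemma cHF_cvars : cHF (cvars h m M c Y) = M.
Proof. by apply: matrix2P; rewrite !mxE inordK. Qed.

Lemma cHAcc14_cvars : cHAcc14 (cvars h m M c Y) = c.
Proof. by rewrite /cHAcc14 mxE inordK. Qed.

(** [cvars] stores three entries of [Y], so only a symmetric block is read back unchanged. *)
Lemma cHAm2_cvars : Y^T = Y -> cHAm2 (cvars h m M c Y) = Y.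
Proof. by move/sym2 => ?; apply: matrix2P; rewrite !mxE inordK. Qed.

End Projections.

Definition cvarsE := (cH_cvars, cHU_cvars, cHF_cvars, cHAcc14_cvars).

Fact cH_is_linear : GRing.linear_for *%R (@cH R).
Proof. by move=> a q d; rewrite /cH !mxE. Qed.
HB.instance Definition _ := GRing.isLinear.Build R 'rV[R]_11 R *%R (@cH R) cH_is_linear.

Fact cHAcc14_is_linear : GRing.linear_for *%R (@cHAcc14 R).
Proof. by move=> a q d; rewrite /cHAcc14 !mxE. Qed.
HB.instance Definition _ :=
  GRing.isLinear.Build R 'rV[R]_11 R *%R (@cHAcc14 R) cHAcc14_is_linear.

Fact cHU_is_linear : linear (@cHU R).
Proof. by move=> a q d; apply/matrixP => i j; rewrite !mxE. Qed.
HB.instance Definition _ :=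
  GRing.isLinear.Build R 'rV[R]_11 'cV[R]_2 *:%R (@cHU R) cHU_is_linear.

Fact cHF_is_linear : linear (@cHF R).
Proof. by move=> a q d; apply/matrixP => i j; rewrite !mxE. Qed.
HB.instance Definition _ :=
  GRing.isLinear.Build R 'rV[R]_11 'M[R]_2 *:%R (@cHF R) cHF_is_linear.

Fact cHAm2_is_linear : linear (@cHAm2 R).
Proof. by move=> a q d; apply/matrixP => i j; rewrite !mxE. Qed.
HB.instance Definition _ :=
  GRing.isLinear.Build R 'rV[R]_11 'M[R]_2 *:%R (@cHAm2 R) cHAm2_is_linear.

Lemma cvars_linear a h h' m m' M M' c c' Y Y' :
  @cvars R (a * h + h') (a *: m + m') (a *: M + M') (a * c + c') (a *: Y + Y') =
  a *: cvars h m M c Y + cvars h' m' M' c' Y'.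
Proof.
apply/rowP => k; rewrite !mxE.
by case: k => [[|[|[|[|[|[|[|[|[|[|[|//]]]]]]]]]]] lk] /=; rewrite ?mxE.
Qed.

End Coordinates.

(** * The admissible domain as a convex cone *)

Section Admissible.
Context {R : realType}.
Implicit Types (q : 'rV[R]_11).

Lemma posdefmxZ n a (M : 'M[R]_n) : 0 < a -> posdefmx M -> posdefmx (a *: M).
Proof.
by move=> a0 pM v v0; rewrite -scalemxAr -scalemxAl mxE mulr_gt0 //; exact: pM.
Qed.

Lemma posdefmxD n (M N : 'M[R]_n) : posdefmx M -> posdefmx N -> posdefmx (M + N).
Proof.
by move=> pM pN v v0; rewrite mulmxDr mulmxDl mxE addr_gt0 //; [exact: pM | exact: pN].
Qed.

Lemma vAm2_sym q : (vAm2 q)^T = vAm2 q.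
Proof. by rewrite /vAm2 linearZ /= cHAm2_sym. Qed.

(** Removes the square root and the quotients by [cH q]. The resulting conditions are visibly stable
    under positive combinations, and by Sylvester's criterion they are open. *)
Lemma admissibleP q :
  admissible R q <-> [/\ 0 < cH q, 0 < cHAcc14 q & posdefmx (cHAm2 q)].
Proof.
have YP : 0 < cH q -> posdefmx (vAm1 q) <-> posdefmx (cHAm2 q).
  move=> h0; rewrite /vAm1 (posdef_sqrtmxP (vAm2_sym q)); split=> pY.
    by rewrite -[cHAm2 q](scalerKV (lt0r_neq0 h0)); exact: posdefmxZ.
  by apply: posdefmxZ; rewrite ?invr_gt0.
split=> [[h0 _ pS c0 cc0] | [h0 C0 pY]].
  split => //; last exact/YP.
  rewrite -(@pmulr_rgt0 _ (cH q)^-1) ?invr_gt0 // mulrC lt_neqAle c0 andbT.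
  (* If [vAcc14 q] were 0, then so would be [(vAcc q)^-1], by the convention [0^-1 = 0]. *)
  by apply: contraTneq cc0 => c00; rewrite /vAcc /vAcc14 -c00 expr0n /= invr0 ltxx.
have pS := (YP h0).2 pY; have [symS _] := posdef_sqrtmx pS.
by split=> //; rewrite ?invr_gt0 ?exprn_gt0 ?ltW // divr_gt0.
Qed.

Lemma admissible_cone x y (s t : R) : admissible R x -> admissible R y ->
  0 < s -> 0 < t -> admissible R (s *: x + t *: y).
Proof.
move=> /admissibleP [hx cx px] /admissibleP [hy cy py] s0 t0; apply/admissibleP.
rewrite !linearD !linearZ /=; split; last by apply: posdefmxD; apply: posdefmxZ.
  by rewrite addr_gt0 // mulr_gt0.
by rewrite addr_gt0 // mulr_gt0.
Qed.

Lemma admissible_convex : convex_set (admissible R).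
Proof.
apply/convex_setW => x y /set_mem ax /set_mem ay k k0 k1.
by apply/mem_set/admissible_cone; rewrite ?subr_gt0.
Qed.

End Admissible.

(** * Traces, inverses and explicit convexity defects *)

Section PosDef2.
Context {R : realType}.
Implicit Types (F V S T A : 'M[R]_2).

Lemma posdef_det S : S^T = S -> posdefmx S -> 0 < \det S.
Proof. by move=> symS /(posdef2P symS) []. Qed.

Lemma posdef_tr S : S^T = S -> posdefmx S -> 0 < \tr S.
Proof.
move=> symS /(posdef2P symS) [a0]; rewrite det2 (sym2 symS) tr2 => d0.
rewrite addr_gt0 // -(pmulr_rgt0 _ a0) (lt_le_trans d0) //.
by rewrite gerBl -expr2 sqr_ge0.
Qed.

Lemma posdef_unit S : S^T = S -> posdefmx S -> S \in unitmx.
Proof. by move=> symS pS; rewrite unitmxE unitfE gt_eqF // posdef_det. Qed.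

(** For a 2x2 matrix the adjugate is [tr S - S]. *)
Lemma invmx2 S : S \in unitmx -> invmx S = (\det S)^-1 *: ((\tr S)%:M - S).
Proof.
move=> uS; apply: (can_inj (mulKmx uS)); rewrite mulmxV //.
have : \det S != 0 by rewrite -unitfE -unitmxE.
rewrite tr2 det2 => dS; apply: matrix2P; rewrite mulmx2 !mxE /=; by field.
Qed.

Lemma posdef_invmx S : S^T = S -> posdefmx S -> posdefmx (invmx S).
Proof.
move=> symS pS v v0; have uS := posdef_unit symS pS.
have -> : v^T *m invmx S *m v = (invmx S *m v)^T *m S *m (invmx S *m v).
  by rewrite trmx_mul trmx_inv symS mulmxA mulmxKV.
apply: pS; apply: contra_neq v0 => E.
by rewrite -[v](mulKVmx uS) E mulmx0.
Qed.

(** The diagonal entries of [X P X^T] are the values of the form [P] at the rows of [X]. The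
    equality case is kept because strict convexity rests on it. *)
Lemma tr_posdef_ge0 m n (X : 'M[R]_(m, n)) P : posdefmx P ->
  0 <= \tr (X *m P *m X^T) ?= iff (X == 0).
Proof.
move=> pP.
have E i : (X *m P *m X^T) i i = ((row i X)^T^T *m P *m (row i X)^T) 0 0.
  rewrite trmxK !mxE; apply: eq_bigr => j _; rewrite !mxE; congr (_ * _).
  by apply: eq_bigr => k _; rewrite !mxE.
have E0 i : 0 <= (X *m P *m X^T) i i.
  rewrite E; have [->|r0] := eqVneq (row i X)^T 0; first by rewrite mulmx0 mxE.
  exact/ltW/pP.
split; first exact: sumr_ge0.
apply/idP/eqP => [|->]; last by rewrite !mul0mx linear0.
rewrite eq_sym psumr_eq0 // => /allP X0; apply/row_matrixP => i; rewrite row0.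
have := X0 i; rewrite mem_index_enum => /(_ isT); rewrite /= E => r0.
apply: contraTeq r0 => r0; rewrite gt_eqF //; apply: pP.
by rewrite -trmx0 (inj_eq trmx_inj).
Qed.

Lemma posdef1 n : posdefmx (1%:M : 'M[R]_n).
Proof.
move=> v v0; rewrite mulmx1 mxE; rewrite lt_neqAle eq_sym psumr_eq0; last first.
  by move=> i _; rewrite mxE -expr2 sqr_ge0.
rewrite sumr_ge0 ?andbT; last by move=> i _; rewrite mxE -expr2 sqr_ge0.
apply: contraNN v0 => /allP v0; apply/eqP/colP => i.
have := v0 i; rewrite mem_index_enum => /(_ isT).
by rewrite /= !mxE mulf_eq0 orbb => /eqP.
Qed.

Lemma tr_mul_tr_ge0 m n (X : 'M[R]_(m, n)) : 0 <= \tr (X *m X^T) ?= iff (X == 0).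
Proof. by have := tr_posdef_ge0 X (@posdef1 n); rewrite mulmx1. Qed.

(** Completion of the square, which exhibits the joint convexity of [tr (F S^-1 F^T)]: for fixed [V]
    the first two terms are linear in [(F, S)], and the defect vanishes when [V = F A]. *)
Lemma tr_gap F V S A : S^T = S -> S *m A = 1%:M -> A *m S = 1%:M ->
  \tr (F *m A *m F^T) = 2 * \tr (F *m V^T) - \tr (V *m S *m V^T)
    + \tr ((F - V *m S) *m A *m (F - V *m S)^T).
Proof.
move=> symS SA AS.
rewrite mulmxBl -(mulmxA V S A) SA mulmx1 linearB /= trmx_mul symS mulmxBr !mulmxBl.
rewrite !mulmxA -(mulmxA F A S) AS mulmx1 !linearB /=.
have -> : \tr (V *m F^T) = \tr (F *m V^T) by rewrite -mxtrace_tr trmx_mul trmxK.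
ring.
Qed.

(* On 2x2 matrices this inverts the Lyapunov operator [D |-> S0 D + D S0], hence
   it is the differential of the square root at [S0^2]. *)
Definition lyap (S0 T : 'M[R]_2) : 'M[R]_2 :=
  (2 * \tr S0)^-1 *: (T + \det S0 *: (invmx S0 *m T *m invmx S0)).

(* Concavity of the square root, with an explicit defect: [S] lies below the
   tangent at [S0] of [Y |-> Y^{1/2}], taken at [Y = S^2]. *)
Lemma sqrt_gap (S0 S : 'M[R]_2) : S0^T = S0 -> posdefmx S0 -> S^T = S ->
  S = 2^-1 *: S0 + lyap S0 (S *m S) - lyap S0 ((S0 - S) *m (S0 - S)).
Proof.
move=> symS0 pS0 symS; have uS := posdef_unit symS0 pS0.
have := posdef_tr symS0 pS0; have := posdef_det symS0 pS0.
rewrite /lyap invmx2 // det2 tr2 (sym2 symS0) => /lt0r_neq0 d0 /lt0r_neq0 t0.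
by apply: matrix2P; rewrite !(mxE, sum2) /= ?(sym2 symS) ?(sym2 symS0);
  field; rewrite ?d0 ?t0.
Qed.
End PosDef2.

(** * Convexity of the entropy *)

Section StateFacts.
Context {R : realType}.
Variables (q : 'rV[R]_11).
Hypothesis (aq : admissible R q).

Lemma cH_gt0 : 0 < cH q. Proof. by case: aq. Qed.
Lemma cH_neq0 : cH q != 0. Proof. by rewrite gt_eqF ?cH_gt0. Qed.
Lemma vAcc14_gt0 : 0 < vAcc14 q.
Proof. by case/admissibleP: aq => h0 c0 _; rewrite divr_gt0. Qed.
Lemma vAm1_sym : (vAm1 q)^T = vAm1 q. Proof. by case: aq. Qed.
Lemma vAm1_posdef : posdefmx (vAm1 q). Proof. by case: aq. Qed.
Lemma vAm1_unit : vAm1 q \in unitmx.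
Proof. exact: posdef_unit vAm1_sym vAm1_posdef. Qed.
Lemma vAm1_sqr : vAm1 q *m vAm1 q = vAm2 q.
Proof. by have [] := posdef_sqrtmx vAm1_posdef. Qed.
Lemma vA_vAm1 : vA q *m vAm1 q = 1%:M. Proof. exact: mulVmx vAm1_unit. Qed.
Lemma vAm1_vA : vAm1 q *m vA q = 1%:M. Proof. exact: mulmxV vAm1_unit. Qed.
Lemma vA_sym : (vA q)^T = vA q. Proof. by rewrite trmx_inv vAm1_sym. Qed.
Lemma vA_posdef : posdefmx (vA q).
Proof. exact: posdef_invmx vAm1_sym vAm1_posdef. Qed.

Lemma cHUE : cHU q = cH q *: vU q. Proof. by rewrite scalerKV ?cH_neq0. Qed.
Lemma cHFE : cHF q = cH q *: vF q. Proof. by rewrite scalerKV ?cH_neq0. Qed.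
Lemma cHAcc14E : cHAcc14 q = cH q * vAcc14 q.
Proof. by rewrite mulrC divfK ?cH_neq0. Qed.
Lemma cHAm2E : cHAm2 q = cH q *: vAm2 q. Proof. by rewrite scalerKV ?cH_neq0. Qed.

End StateFacts.

Section Convexity.
Context {R : realType}.
Variables g G : R.
Hypotheses (g0 : 0 < g) (G0 : 0 < G).
Implicit Types (q z : 'rV[R]_11).

Lemma lyap_is_linear (S : 'M[R]_2) : linear (lyap S).
Proof.
move=> a X Y; rewrite /lyap mulmxDr mulmxDl -scalemxAr -scalemxAl.
set P := _ *m X *m _; set Q := _ *m Y *m _; set c := (2 * _)^-1.
by apply/matrixP => i j; rewrite !mxE; ring.
Qed.
HB.instance Definition _ S := GRing.isLinear.Build R _ _ *:%R (lyap S) (lyap_is_linear S).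

(* [H tr (F A F^T)] is positively homogeneous of degree 1 in [(h, HF, HA_h^{-2})],
   so it contributes no constant to the tangent at [z]. *)
Definition tangent z q : R :=
  g * cH z * (cH q - cH z / 2)
  + ((vU z)^T *m cHU q) 0 0 - cH q / 2 * ((vU z)^T *m vU z) 0 0
  + G / 2 * (4 * cH z ^+ 2 * vAcc14 z ^+ 3 * cHAcc14 q
             - cH z ^+ 2 * vAcc14 z ^+ 4 * cH q - 2 * cH z ^+ 3 * vAcc14 z ^+ 4
             + 2 * \tr (cHF q *m (vF z *m vA z)^T)
             - \tr (vF z *m vA z
                      *m (cH q *: (2^-1 *: vAm1 z) + lyap (vAm1 z) (cHAm2 q))
                      *m (vF z *m vA z)^T)).

(** The defects of, in order, the gravity term, the kinetic energy, the vertical elastic energy,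
    [tr_gap] with [V = F_z A_z], and [sqrt_gap] at [A_z^-1]. With [C = h c] the vertical energy is
    [(C^2)^2 / h], up to the factor [G / 2]: its two squares are the defect of this quotient in
    [(C^2, h)], then that of [C^2]. Traces are put in the shape required by [tr_posdef_ge0] and
    [tr_mul_tr_ge0]. *)
Definition tangent_gap z q : R :=
  g / 2 * (cH q - cH z) ^+ 2
  + cH q / 2 * \tr ((vU q - vU z)^T *m (vU q - vU z)^T^T)
  + G / 2 * (cH q * (cH q * vAcc14 q ^+ 2 - cH z * vAcc14 z ^+ 2) ^+ 2
             + 2 * (cH z * vAcc14 z ^+ 2)
                 * (cH q * vAcc14 q - cH z * vAcc14 z) ^+ 2)
  + G / 2 * (cH q * \tr ((vF q - vF z *m vA z *m vAm1 q) *m vA q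
                         *m (vF q - vF z *m vA z *m vAm1 q)^T))
  + G / 2 * (cH q * ((2 * \tr (vAm1 z))^-1 *
      (\tr (vF z *m vA z *m (vAm1 z - vAm1 q)
            *m (vF z *m vA z *m (vAm1 z - vAm1 q))^T)
       + \det (vAm1 z) * \tr (vF z *m vA z *m vA z *m (vAm1 z - vAm1 q)
            *m (vF z *m vA z *m vA z *m (vAm1 z - vAm1 q))^T)))).

(** [tr_gap] leaves a term linear in [vAm1 q] with a minus sign; [sqrt_gap] replaces [vAm1 q] by its
    tangent at [z], linear in [(h, H A_h^-2)] once multiplied by [h], and the concavity defect comes
    out with a plus sign. *)
Lemma entropy_tangent z q : admissible R z -> admissible R q ->
  entropy g G q = tangent z q + tangent_gap z q.
Proof.
move=> az aq; rewrite /entropy /tangent /tangent_gap.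
rewrite (cHUE aq) (cHFE aq) (cHAcc14E aq) (cHAm2E aq) -(vAm1_sqr aq).
rewrite (tr_gap (vF q) (vF z *m vA z) (vAm1_sym aq) (vAm1_vA aq) (vA_vAm1 aq)).
set V := vF z *m vA z; set T := vAm1 z - vAm1 q.
have symT : T^T = T by rewrite linearB /= vAm1_sym // vAm1_sym.
have E : \tr (V *m vAm1 q *m V^T) = \tr (V *m (2^-1 *: vAm1 z) *m V^T)
   + \tr (V *m lyap (vAm1 z) (vAm1 q *m vAm1 q) *m V^T)
   - (2 * \tr (vAm1 z))^-1 * (\tr (V *m T *m (V *m T)^T) + \det (vAm1 z) *
     \tr (V *m vA z *m T *m (V *m vA z *m T)^T)).
  rewrite [in LHS](sqrt_gap (vAm1_sym az) (vAm1_posdef az) (vAm1_sym aq)).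
  rewrite mulmxBr mulmxDr mulmxBl mulmxDl raddfB /= mxtraceD; congr (_ + _ - _).
  rewrite -/T /lyap -scalemxAr -scalemxAl mxtraceZ; congr (_ * _).
  rewrite mulmxDr mulmxDl mxtraceD -scalemxAr -scalemxAl mxtraceZ.
  rewrite !trmx_mul symT (vA_sym az) !mulmxA; done.
rewrite E {E} [lyap _ (_ *: _)]linearZ /= -scalerDr.
move: (lyap _ _) (vU q) (vU z) (vF q) => L u w F; set J := F - _; clearbody V T J.
rewrite -!(scalemxAr, scalemxAl) mulmxDr mulmxDl !mxtraceZ mxtraceD !trmxK.
rewrite -!scalemxAr -!scalemxAl mxtraceZ.
rewrite /vAcc !mxE [\tr ((_ - _)^T *m _)]trace_mx11 !mxE !sum2 !mxE.
by field; rewrite !gt_eqF // posdef_tr ?vAm1_sym //; exact: vAm1_posdef.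
Qed.

(** Each summand is nonnegative, so all vanish together. The last two equalities determine [F] and
    [A_h] only once [vF z *m vA z] is invertible, which is left to the next lemma. *)
Lemma tangent_gap_ge0 z q : admissible R z -> admissible R q ->
  0 <= tangent_gap z q /\ (tangent_gap z q <= 0 ->
    [/\ cH q = cH z, vU q = vU z, cHAcc14 q = cHAcc14 z,
        vF q = vF z *m vA z *m vAm1 q
      & vF z *m vA z *m (vAm1 z - vAm1 q) = 0]).
Proof.
move=> az aq; have hq := cH_gt0 aq; have hz := cH_gt0 az.
have tz := posdef_tr (vAm1_sym az) (vAm1_posdef az).
have dz := posdef_det (vAm1_sym az) (vAm1_posdef az).
have cz := vAcc14_gt0 az.
(* Nonnegativity and the consequence of vanishing are carried along in pairs. *)
have pos (a x : R) : 0 < a -> 0 <= x -> 0 <= a * x /\ (a * x = 0 -> x = 0).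
  move=> a0 x0; split; first by rewrite mulr_ge0 // ltW.
  by move/eqP; rewrite mulf_eq0 gt_eqF //= => /eqP.
have sum (x y : R) : 0 <= x -> 0 <= y -> 0 <= x + y /\ (x + y = 0 -> x = 0).
  move=> x0 y0; split=> [|/eqP]; first exact: addr_ge0.
  by rewrite paddr_eq0 // => /andP[/eqP].
have sqr (x y : R) : (x - y) ^+ 2 = 0 -> x = y.
  by move/eqP; rewrite sqrf_eq0 subr_eq0 => /eqP.
have lt02 : 0 < 2 :> R by rewrite ltr0n.
have G2 : 0 < G / 2 by rewrite divr_gt0.
have [p1 e1] := pos (g / 2) _ (divr_gt0 g0 lt02) (sqr_ge0 (cH q - cH z)).
have [p2 e2] := pos (cH q / 2) _ (divr_gt0 hq lt02)
  (tr_mul_tr_ge0 (vU q - vU z)^T).1.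
have [p3 e3] : let x := G / 2 * (cH q * (cH q * vAcc14 q ^+ 2 - cH z * vAcc14 z ^+ 2) ^+ 2
             + 2 * (cH z * vAcc14 z ^+ 2)
                 * (cH q * vAcc14 q - cH z * vAcc14 z) ^+ 2) in
    0 <= x /\ (x = 0 -> cHAcc14 q = cHAcc14 z).
  (* The second square has a positive coefficient and already compares the values of [h c]. *)
  rewrite (cHAcc14E aq) (cHAcc14E az) addrC.
  have [p e] := pos (2 * (cH z * vAcc14 z ^+ 2))
    ((cH q * vAcc14 q - cH z * vAcc14 z) ^+ 2)
    (mulr_gt0 lt02 (mulr_gt0 hz (exprn_gt0 2 cz))) (sqr_ge0 _).
  have [p' _] := pos (cH q)
    ((cH q * vAcc14 q ^+ 2 - cH z * vAcc14 z ^+ 2) ^+ 2) hq (sqr_ge0 _).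
  have [ps es] := sum _ _ p p'; have [p'' e''] := pos _ _ G2 ps.
  by split=> // /e'' /es /e /sqr.
have [p4 e4] := pos _ _ hq
  (tr_posdef_ge0 (vF q - vF z *m vA z *m vAm1 q) (vA_posdef aq)).1.
have [{}p4 {}e4'] := pos _ _ G2 p4.
have [p5 e5] := sum _ _ (tr_mul_tr_ge0 (vF z *m vA z *m (vAm1 z - vAm1 q))).1
  (pos _ _ dz (tr_mul_tr_ge0 (vF z *m vA z *m vA z *m (vAm1 z - vAm1 q))).1).1.
have t2 : 0 < (2 * \tr (vAm1 z))^-1 by rewrite invr_gt0 mulr_gt0.
have [{}p5 e5'] := pos _ _ t2 p5.
have [{}p5 e5''] := pos _ _ hq p5.
have [{}p5 e5'''] := pos _ _ G2 p5.
rewrite /tangent_gap; split; first by rewrite !addr_ge0.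
rewrite le_eqVlt ltNge !addr_ge0 // orbF !paddr_eq0 ?addr_ge0 // -!andbA.
move=> /and5P[/eqP t1 /eqP t2' /eqP t3 /eqP t4 /eqP t5]; split.
- exact/sqr/e1.
- move/eqP: (e2 t2'); rewrite eq_sym (tr_mul_tr_ge0 _).2.
  by rewrite -trmx0 (inj_eq (@trmx_inj _ _ _)) subr_eq0 => /eqP.
- exact: e3.
- apply/eqP; rewrite -subr_eq0 -(tr_posdef_ge0 _ (vA_posdef aq)).2 eq_sym.
  exact/eqP/e4/e4'.
- apply/eqP; rewrite -(tr_mul_tr_ge0 _).2 eq_sym.
  exact/eqP/e5/e5'/e5''/e5'''.
Qed.

(** The tangency point [z] will be a point of a chord and need not be a state, so invertibility
    comes from [q]: [det F_q] is nonzero and [F_q = F_z A_z S_q], hence [F_z A_z] is invertible and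
    can be cancelled to give [S_q = S_z]. *)
Lemma tangent_gap_gt0 z q : admissible R z -> state q -> q != z ->
  0 < tangent_gap z q.
Proof.
move=> az [aq detq]; apply: contraNT; rewrite -leNgt => le0.
have [_ /(_ le0) [eh eu ec eF eT]] := tangent_gap_ge0 az aq.
have uV : vF z *m vA z \in unitmx.
  have : vF q \in unitmx.
    rewrite unitmxE unitfE; apply: contra_eq_neq detq => ->.
    by rewrite mulr0 eq_sym oner_eq0.
  by rewrite eF unitmx_mul => /andP[].
have eS : vAm1 q = vAm1 z.
  apply/eqP; rewrite eq_sym -subr_eq0; apply/eqP.
  by rewrite -(mulKmx uV (vAm1 z - vAm1 q)) eT mulmx0.
apply/eqP/blocks_eq => //.
- by rewrite (cHUE aq) (cHUE az) eu eh.
- by rewrite (cHFE aq) (cHFE az) eF eh eS -mulmxA vA_vAm1 // mulmx1.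
- by rewrite (cHAm2E aq) (cHAm2E az) -(vAm1_sqr aq) -(vAm1_sqr az) eS eh.
Qed.

Lemma tangent_id z : admissible R z -> tangent z z = entropy g G z.
Proof.
move=> az; rewrite (entropy_tangent az az) /tangent_gap.
rewrite -(mulmxA (vF z)) vA_vAm1 // mulmx1 !subrr !mulmx0 !mul0mx !trmx0 !mul0mx !linear0.
by rewrite !(expr0n, mulr0, addr0).
Qed.

Lemma tangentD z x y (s t : R) : s + t = 1 ->
  tangent z (s *: x + t *: y) = s * tangent z x + t * tangent z y.
Proof.
move=> st; have tE : t = 1 - s by rewrite -st addrC addKr.
have eH : cH (s *: x + t *: y) = s * cH x + t * cH y by rewrite linearD !linearZ.
have eC : cHAcc14 (s *: x + t *: y) = s * cHAcc14 x + t * cHAcc14 y.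
  by rewrite linearD !linearZ.
have eU : cHU (s *: x + t *: y) = s *: cHU x + t *: cHU y.
  by rewrite linearD !linearZ.
have eF : cHF (s *: x + t *: y) = s *: cHF x + t *: cHF y.
  by rewrite linearD !linearZ.
have eY : lyap (vAm1 z) (cHAm2 (s *: x + t *: y)) =
    s *: lyap (vAm1 z) (cHAm2 x) + t *: lyap (vAm1 z) (cHAm2 y).
  have -> : cHAm2 (s *: x + t *: y) = s *: cHAm2 x + t *: cHAm2 y.
    by rewrite linearD !linearZ.
  by rewrite linearD; congr (_ + _); exact: linearZ.
rewrite /tangent {}eH {}eC {}eU {}eF {}eY.
move: (lyap _ (cHAm2 x)) (lyap _ (cHAm2 y)) => Lx Ly.
move: (vF z *m vA z) (2^-1 *: vAm1 z) (cHF x) (cHF y) => V S Fx Fy.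
have -> : V *m ((s * cH x + t * cH y) *: S + (s *: Lx + t *: Ly)) *m V^T =
    s *: (V *m (cH x *: S + Lx) *m V^T) + t *: (V *m (cH y *: S + Ly) *m V^T).
  rewrite scalerDl addrACA -!scalerA -!scalerDr mulmxDr mulmxDl.
  by rewrite -!scalemxAr -!scalemxAl.
have -> : (s *: Fx + t *: Fy) *m V^T = s *: (Fx *m V^T) + t *: (Fy *m V^T).
  by rewrite mulmxDl -!scalemxAl.
have -> : (vU z)^T *m (s *: cHU x + t *: cHU y)
    = s *: ((vU z)^T *m cHU x) + t *: ((vU z)^T *m cHU y).
  by rewrite mulmxDr -!scalemxAr.
have e0 (X Y : 'M[R]_1) : (s *: X + t *: Y) 0 0 = s * X 0 0 + t * Y 0 0 by rewrite !mxE.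
by rewrite !mxtraceD !mxtraceZ e0 tE; ring.
Qed.

(** The tangent at the intermediate point is affine, agrees with the entropy there, and lies below
    it at both endpoints. *)
Lemma entropy_convex : convex_function (admissible R) (entropy g G).
Proof.
move=> t x y ax ay.
have az : admissible R (t%:num *: x + (1 - t%:num) *: y).
  exact: set_mem (admissible_convex t ax ay).
move: ax ay => /set_mem ax /set_mem ay; rewrite convRE /=.
rewrite -(tangent_id az) tangentD ?subrKC //.
rewrite (entropy_tangent az ax) (entropy_tangent az ay).
by rewrite lerD // ler_wpM2l // lerDl;
  [case: (tangent_gap_ge0 az ax) | case: (tangent_gap_ge0 az ay)].
Qed.

(** As for convexity, with a strict gap at the endpoint [q], which is a state; at [y] a nonnegative
    gap is enough. *)
Lemma entropy_strictly_convex q : state q ->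
  strictly_convex_at (admissible R) (entropy g G) q.
Proof.
move=> sq y t ay yq /andP[t0 t1]; have [aq _] := sq.
have t1' : 0 < 1 - t by rewrite subr_gt0.
have az : admissible R (t *: q + (1 - t) *: y) by exact: admissible_cone.
have qz : q != t *: q + (1 - t) *: y.
  (* If [q] were the intermediate point, then [(1 - t) y = (1 - t) q], and [1 - t] cancels. *)
  apply: contra_neq yq => E.
  have t1n : 1 - t != 0 by rewrite gt_eqF.
  apply: (scalerI t1n); rewrite [RHS]scalerBl scale1r.
  by rewrite [X in _ = X - _]E addrAC subrr add0r.
rewrite -(tangent_id az) tangentD ?subrKC //.
rewrite (entropy_tangent az aq) (entropy_tangent az ay).
have gq := tangent_gap_gt0 az sq qz; have [gy _] := tangent_gap_ge0 az ay.
by rewrite ltr_leD // ?ltr_pM2l ?ler_pM2l // ?ltrDl ?lerDl.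
Qed.
End Convexity.

(** * Differentials of the flux and of the entropy *)

Section Calculus.
Context {R : realType} {V : normedModType R}.
Implicit Types (x : V) (f g df dg : V -> R).

(** The differential depends only on the germ. This is needed because [sqrtmx] and [invmx] are given
    by closed formulas only at admissible points. *)
Lemma is_diff_near x f g df :
  (\near x, f x = g x) -> is_diff x f df -> is_diff x g df.
Proof.
move=> fg [dfx <-]; have /diff_locallyP [cd E] := dfx.
have fgx : f x = g x by exact: nbhs_singleton fg.
have Eg : g \o shift x = cst (g x) + 'd f x +o_ 0 id.
  apply/eqaddoP => e e0; have /eqaddoP /(_ e e0) := E.
  have : \forall h \near (0 : V), f (h + x) = g (h + x).
    move: fg; rewrite (near_shift 0) subr0. by apply: filterS => h.
  by apply: filterS2 => h fgh; rewrite !fctE /= -fgx -fgh.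
have dE := diff_unique cd Eg.
suff dg : differentiable g x by apply: (@DiffDef _ _ _ _ _ _ _ dg); exact: dE.
by apply/diff_locallyP; rewrite dE; split.
Qed.

Lemma is_diff_coord m n (N : 'M[R]_(m, n)) i j :
  is_diff N (fun M => M i j : R) (fun M => M i j : R).
Proof.
have @f : {linear 'M[R]_(m, n) -> R}.
  by exists (fun N : 'M[R]_(_, _) => N i j); do 2![eexists]; do ?[constructor];
     rewrite ?mxE// => ? *; rewrite ?mxE//; move=> ?; rewrite !mxE.
apply: DiffDef; first exact: differentiable_coord.
exact: (@diff_lin _ _ _ f N (@coord_continuous R m n i j)).
Qed.

Lemma is_diff_mul x f g df dg : is_diff x f df -> is_diff x g dg ->
  is_diff x (fun z => f z * g z) (fun d => f x * dg d + g x * df d).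
Proof. by move=> fx gx; exact: is_diffM. Qed.

Lemma is_diff_add x f g df dg : is_diff x f df -> is_diff x g dg ->
  is_diff x (fun z => f z + g z) (fun d => df d + dg d).
Proof. by move=> fx gx; exact: is_diffD. Qed.

Lemma is_diff_opp x f df : is_diff x f df ->
  is_diff x (fun z => - f z) (fun d => - df d).
Proof. by move=> fx; exact: is_diffN. Qed.

Lemma is_diff_const x (c : R) : is_diff x (fun=> c) (fun=> 0).
Proof. exact: is_diff_cst. Qed.

Lemma is_diff_inv x f df : f x != 0 -> is_diff x f df ->
  is_diff x (fun z => (f z)^-1) (fun d => - (f x) ^- 2 * df d).
Proof.
move=> fx0 [dfx <-]; apply: DiffDef; first exact: differentiableV.
by rewrite diffV.
Qed.

Lemma is_diff_pow x f df n : is_diff x f df ->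
  is_diff x (fun z => f z ^+ n.+1) (fun d => n.+1%:R * f x ^+ n * df d).
Proof. by move=> fx; have := is_diffX n fx; rewrite exprfctE. Qed.

Lemma is_diff_change x f df dg : is_diff x f df -> df =1 dg -> is_diff x f dg.
Proof. by move=> fx /funext <-. Qed.

Lemma differentiable_sqrt x f : 0 < f x -> differentiable f x ->
  differentiable (fun z => Num.sqrt (f z)) x.
Proof.
move=> fx0 dfx; apply: (@differentiable_comp _ _ _ _ f (@Num.sqrt R)) => //.
by apply/derivable1_diffP; have [] := is_derive1_sqrt fx0.
Qed.

End Calculus.

Section MatrixCalculus.
Context {R : realType} {V : normedModType R}.
Implicit Types (x : V).

(** Taken entrywise, so that the scalar rules of differentiation suffice and matrix identities can
    be differentiated term by term. *)
Definition is_diffmx x m n (f df : V -> 'M[R]_(m, n)) :=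
  forall i j, is_diff x (fun z => f z i j : R) (fun d => df d i j : R).

Lemma is_diffmx_change x m n (f df df' : V -> 'M[R]_(m, n)) :
  is_diffmx x f df -> df =1 df' -> is_diffmx x f df'.
Proof. by move=> fx e i j; apply: is_diff_change (fx i j) _ => d; rewrite e. Qed.

Lemma is_diffmx_ext x m n (f g df : V -> 'M[R]_(m, n)) :
  f =1 g -> is_diffmx x f df -> is_diffmx x g df.
Proof. by move=> /funext <-. Qed.

Lemma is_diffmx_near x m n (f g df : V -> 'M[R]_(m, n)) :
  (\near x, f x = g x) -> is_diffmx x f df -> is_diffmx x g df.
Proof.
move=> fg fx i j; apply: is_diff_near (fx i j).
by apply: filterS fg => z ->.
Qed.

Lemma is_diffmx_unique x m n (f df df' : V -> 'M[R]_(m, n)) :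
  is_diffmx x f df -> is_diffmx x f df' -> df =1 df'.
Proof.
move=> fx fx' d; apply/matrixP => i j.
have [_ e] := fx i j; have [_ e'] := fx' i j.
exact: (congr1 (@^~ d) (etrans (esym e) e')).
Qed.

Lemma is_diffmx_const x m n (M : 'M[R]_(m, n)) : is_diffmx x (fun=> M) (fun=> 0).
Proof.
by move=> i j; apply: is_diff_change (is_diff_const x (M i j)) _ => d; rewrite mxE.
Qed.

Lemma is_diffmx_add x m n (f g df dg : V -> 'M[R]_(m, n)) :
  is_diffmx x f df -> is_diffmx x g dg ->
  is_diffmx x (fun z => f z + g z) (fun d => df d + dg d).
Proof.
move=> fx gx i j; have H := is_diff_add (fx i j) (gx i j).
rewrite (_ : (fun z => _) = (fun z => f z i j + g z i j)); last first.
  by apply/funext => z; rewrite mxE.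
by apply: is_diff_change H _ => d; rewrite mxE.
Qed.

Lemma is_diffmx_scale x m n k dk (f df : V -> 'M[R]_(m, n)) :
  is_diff x (k : V -> R) (dk : V -> R) -> is_diffmx x f df ->
  is_diffmx x (fun z => k z *: f z) (fun d => k x *: df d + dk d *: f x).
Proof.
move=> kx fx i j; have H := is_diff_mul kx (fx i j).
rewrite (_ : (fun z => _) = (fun z => k z * f z i j)); last first.
  by apply/funext => z; rewrite mxE.
by apply: is_diff_change H _ => d; rewrite !mxE [f x i j * _]mulrC.
Qed.

Lemma is_diffmx_opp x m n (f df : V -> 'M[R]_(m, n)) :
  is_diffmx x f df -> is_diffmx x (fun z => - f z) (fun d => - df d).
Proof.
move=> fx i j; have H := is_diff_opp (fx i j).
rewrite (_ : (fun z => _) = (fun z => - f z i j)); last first.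
  by apply/funext => z; rewrite mxE.
by apply: is_diff_change H _ => d; rewrite mxE.
Qed.

Lemma is_diffmx_tr x m n (f df : V -> 'M[R]_(m, n)) :
  is_diffmx x f df -> is_diffmx x (fun z => (f z)^T) (fun d => (df d)^T).
Proof.
move=> fx i j; rewrite (_ : (fun z => _) = (fun z => f z j i)); last first.
  by apply/funext => z; rewrite mxE.
by apply: is_diff_change (fx j i) _ => d; rewrite mxE.
Qed.

Lemma is_diff_bigsum x n (f df : 'I_n -> V -> R) :
  (forall i, is_diff x (f i) (df i)) ->
  is_diff x (fun z => \sum_i f i z) (fun d => \sum_i df i d).
Proof.
elim: n f df => [|n IH] f df fx.
  rewrite (_ : (fun z => _) = (fun=> 0)); last first.
    by apply/funext => z; rewrite big_ord0.
  by apply: is_diff_change (is_diff_const x 0) _ => d; rewrite big_ord0.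
rewrite (_ : (fun z => _) = (fun z => f ord0 z + \sum_i f (lift ord0 i) z)); last first.
  by apply/funext => z; rewrite big_ord_recl.
apply: is_diff_change (is_diff_add (fx ord0) (IH _ _ (fun i => fx (lift ord0 i)))) _.
by move=> d; rewrite big_ord_recl.
Qed.

Lemma is_diffmx_mul x m n p (f df : V -> 'M[R]_(m, n)) (g dg : V -> 'M[R]_(n, p)) :
  is_diffmx x f df -> is_diffmx x g dg ->
  is_diffmx x (fun z => f z *m g z) (fun d => df d *m g x + f x *m dg d).
Proof.
move=> fx gx i j.
have H := is_diff_bigsum (fun k => is_diff_mul (fx i k) (gx k j)).
rewrite (_ : (fun z => _) = (fun z => \sum_k f z i k * g z k j)); last first.
  by apply/funext => z; rewrite mxE.
apply: is_diff_change H _ => d; rewrite !mxE -big_split /=.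
by apply: eq_bigr => k _; rewrite addrC [g x k j * _]mulrC.
Qed.

Lemma is_diff_trace x n (f df : V -> 'M[R]_n) :
  is_diffmx x f df -> is_diff x (fun z => \tr (f z)) (fun d => \tr (df d)).
Proof. by move=> fx; apply: (is_diff_bigsum (fun i => fx i i)). Qed.

(** Provides some differential when its formula is found afterwards, by differentiating an identity,
    or is of no interest. *)
Lemma is_diffmx_differentiable x m n (f : V -> 'M[R]_(m, n)) :
  (forall i j, differentiable (fun z => f z i j : R) x) ->
  exists df, is_diffmx x f df.
Proof.
move=> fx; exists (fun d => \matrix_(i, j) ('d (fun z => f z i j : R) x d)) => i j.
apply: is_diff_change (differentiableP (fx i j)) _ => d.
by rewrite mxE.
Qed.

End MatrixCalculus.

(** Since [det S S^-1 = tr S - S], the products [S X] and [X S] cancel and [2 tr S X] remains. *)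
Lemma lyapP (R : realType) (S X : 'M[R]_2) : S^T = S -> posdefmx S ->
  lyap S (S *m X + X *m S) = X.
Proof.
move=> symS pS; have uS := posdef_unit symS pS.
have d0 : \det S != 0 by rewrite -unitfE -unitmxE.
have t0 := lt0r_neq0 (posdef_tr symS pS).
have E : \det S *: invmx S = (\tr S)%:M - S by rewrite invmx2 // scalerKV.
have -> : lyap S (S *m X + X *m S) = (2 * \tr S)^-1 *:
    (S *m X + X *m S + (X *m (\det S *: invmx S) + \det S *: invmx S *m X)).
  rewrite /lyap mulmxDr mulmxDl mulKmx // -!mulmxA mulmxV // mulmx1.
  by rewrite [\det S *: _]scalerDr -scalemxAr -scalemxAl.
rewrite E mulmxBr mulmxBl mul_mx_scalar mul_scalar_mx.
move: (S *m X) (X *m S) (\tr S) t0 => P Q t t0.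
by apply/matrixP => i j; rewrite !mxE; field.
Qed.

Section Derivatives.
Context {R : realType}.
Implicit Types (q d : 'rV[R]_11).

(** Differentials at [q] in the direction [d]. The quotient rule is written as
    [(d(h v) - v dh) / h], the form in which the conservation of mass cancels against the other
    equations. *)
Definition dvU q d : 'cV[R]_2 := (cH q)^-1 *: (cHU d - cH d *: vU q).
Definition dvF q d : 'M[R]_2 := (cH q)^-1 *: (cHF d - cH d *: vF q).
Definition dvAcc14 q d : R := (cHAcc14 d - cH d * vAcc14 q) / cH q.
Definition dvAm2 q d : 'M[R]_2 := (cH q)^-1 *: (cHAm2 d - cH d *: vAm2 q).
Definition dvAm1 q d : 'M[R]_2 := lyap (vAm1 q) (dvAm2 q d).
Definition dvA q d : 'M[R]_2 := - (vA q *m dvAm1 q d *m vA q).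

Lemma is_diff_cH q : is_diff q (@cH R) (@cH R).
Proof. exact: is_diff_coord. Qed.

Lemma is_diff_cHAcc14 q : is_diff q (@cHAcc14 R) (@cHAcc14 R).
Proof. exact: is_diff_coord. Qed.

Lemma is_diffmx_cHU q : is_diffmx q (@cHU R) (@cHU R).
Proof.
move=> i j; rewrite (_ : (fun z => _) = (fun z : 'rV[R]_11 => z 0 (inord (1 + i)))).
  exact: is_diff_coord.
by apply/funext => z; rewrite mxE.
Qed.

Lemma is_diffmx_cHF q : is_diffmx q (@cHF R) (@cHF R).
Proof.
move=> i j;
  rewrite (_ : (fun z => _) = (fun z : 'rV[R]_11 => z 0 (inord (3 + (i.*2 + j))))).
  exact: is_diff_coord.
by apply/funext => z; rewrite mxE.
Qed.

Lemma is_diffmx_cHAm2 q : is_diffmx q (@cHAm2 R) (@cHAm2 R).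
Proof.
move=> i j; rewrite (_ : (fun z => _) = (fun z : 'rV[R]_11 => z 0 (inord (8 + (i + j))))).
  exact: is_diff_coord.
by apply/funext => z; rewrite mxE.
Qed.

Section AtAdmissible.
Variable q : 'rV[R]_11.
Hypothesis aq : admissible R q.

Lemma is_diffmx_ratio m n (f : 'rV[R]_11 -> 'M[R]_(m, n)) : is_diffmx q f f ->
  is_diffmx q (fun z => (cH z)^-1 *: f z)
    (fun d => (cH q)^-1 *: (f d - cH d *: ((cH q)^-1 *: f q))).
Proof.
move=> fq; have hV := is_diff_inv (cH_neq0 aq) (is_diff_cH q).
apply: is_diffmx_change (is_diffmx_scale hV fq) _ => d.
apply/matrixP => i j; rewrite !mxE; field; exact: cH_neq0.
Qed.

Lemma is_diffmx_vU : is_diffmx q (@vU R) (dvU q).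
Proof. exact: is_diffmx_ratio (is_diffmx_cHU q). Qed.

Lemma is_diffmx_vF : is_diffmx q (@vF R) (dvF q).
Proof. exact: is_diffmx_ratio (is_diffmx_cHF q). Qed.

Lemma is_diffmx_vAm2 : is_diffmx q (@vAm2 R) (dvAm2 q).
Proof. exact: is_diffmx_ratio (is_diffmx_cHAm2 q). Qed.

Lemma is_diff_vAcc14 : is_diff q (@vAcc14 R) (dvAcc14 q).
Proof.
have hV := is_diff_inv (cH_neq0 aq) (is_diff_cH q).
apply: is_diff_change (is_diff_mul (is_diff_cHAcc14 q) hV) _ => d.
by rewrite /dvAcc14 /vAcc14; field; exact: cH_neq0.
Qed.

(** By [admissibleP] and Sylvester's criterion, admissibility is the strict positivity of four
    continuous functions. *)
Lemma near_admissible : \near q, admissible R q.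
Proof.
have pos (f df : 'rV[R]_11 -> R) : is_diff q f df -> 0 < f q -> \near q, 0 < f q.
  by move=> [/differentiable_continuous fq _]; exact: (cvgr_gt _ fq).
have /admissibleP [h0 c0 pY] := aq.
have [Y0 dY0] := (posdef2P (cHAm2_sym q)).1 pY.
have Yq := is_diffmx_cHAm2 q.
have hn := pos _ _ (is_diff_cH q) h0.
have cn := pos _ _ (is_diff_cHAcc14 q) c0.
have yn := pos _ _ (Yq 0 0) Y0.
have dn : \near q, 0 < \det (cHAm2 q).
  apply: (pos (fun z => \det (cHAm2 z))) => //.
  rewrite (_ : (fun z => _) = (fun z => cHAm2 z 0 0 * cHAm2 z 1 1
    + - (cHAm2 z 0 1 * cHAm2 z 1 0))); last by apply/funext => z; rewrite det2.
  exact: is_diff_add (is_diff_mul (Yq 0 0) (Yq 1 1))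
    (is_diff_opp (is_diff_mul (Yq 0 1) (Yq 1 0))).
near=> z; apply/admissibleP; split.
- by near: z.
- by near: z.
apply/posdef2P; first exact: cHAm2_sym.
by split; near: z.
Unshelve. all: by end_near. Qed.

Lemma vAm1E z : admissible R z -> vAm1 z = sqrt2 (vAm2 z).
Proof.
move=> az; rewrite /vAm1 sqrtmxE ?vAm2_sym //.
exact/(posdef_sqrtmxP (vAm2_sym z))/vAm1_posdef.
Qed.

(** The closed formula for the root gives differentiability only; the differential is then obtained
    by differentiating [S S = A_h^-2] and solving the Lyapunov equation with [lyapP]. *)
Lemma is_diffmx_vAm1 : is_diffmx q (@vAm1 R) (dvAm1 q).
Proof.
have pY : posdefmx (vAm2 q).
  exact/(posdef_sqrtmxP (vAm2_sym q))/vAm1_posdef.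
have [Y0 dY0] := (posdef2P (vAm2_sym q)).1 pY.
have tY0 := posdef_tr (vAm2_sym q) pY.
have [dS Sq0] : exists dS, is_diffmx q (fun z => sqrt2 (vAm2 z)) dS.
  have dY i j : differentiable (fun z => vAm2 z i j : R) q.
    by have [] := is_diffmx_vAm2 i j.
  have dd : differentiable (fun z => Num.sqrt (\det (vAm2 z))) q.
    apply: differentiable_sqrt => //.
    rewrite (_ : (fun z => _) = (fun z => vAm2 z 0 0 * vAm2 z 1 1
      - (vAm2 z 0 1 * vAm2 z 1 0))); last by apply/funext => z; rewrite det2.
    by apply: differentiableB; apply: differentiableM.
  have dt : differentiable (fun z => \tr (vAm2 z) + 2 * Num.sqrt (\det (vAm2 z))) q.
    apply: differentiableD.
      rewrite (_ : (fun z => _) = (fun z => vAm2 z 0 0 + vAm2 z 1 1)).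
        exact: differentiableD.
      by apply/funext => z; rewrite tr2.
    exact: differentiableM (differentiable_cst _ _) dd.
  have t0 : 0 < \tr (vAm2 q) + 2 * Num.sqrt (\det (vAm2 q)).
    by rewrite addr_gt0 // mulr_gt0 // sqrtr_gt0.
  apply: is_diffmx_differentiable => i j.
  rewrite (_ : (fun z => _) = (fun z =>
    (Num.sqrt (\tr (vAm2 z) + 2 * Num.sqrt (\det (vAm2 z))))^-1
     * (vAm2 z i j + Num.sqrt (\det (vAm2 z)) * (i == j)%:R))); last first.
    by apply/funext => z; rewrite !mxE mulr_natr.
  apply: differentiableM.
    apply: differentiableV; first exact: differentiable_sqrt.
    by rewrite gt_eqF // sqrtr_gt0.
  apply: differentiableD => //.
  exact: differentiableM dd (differentiable_cst _ _).
have Sq : is_diffmx q (@vAm1 R) dS.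
  apply: is_diffmx_near Sq0; apply: filterS near_admissible => z az.
  by rewrite vAm1E.
apply: is_diffmx_change (Sq) _ => d; rewrite /dvAm1.
have SS : is_diffmx q (fun z => vAm1 z *m vAm1 z) (dvAm2 q).
  apply: is_diffmx_near is_diffmx_vAm2; apply: filterS near_admissible => z az.
  by rewrite vAm1_sqr.
rewrite (is_diffmx_unique SS (is_diffmx_mul Sq Sq) d) addrC.
by rewrite lyapP ?vAm1_sym //; exact: vAm1_posdef.
Qed.

(** Same scheme: the adjugate formula gives differentiability, and the differential follows from
    [A S = 1]. *)
Lemma is_diffmx_vA : is_diffmx q (@vA R) (dvA q).
Proof.
have dS0 := lt0r_neq0 (posdef_det (vAm1_sym aq) (vAm1_posdef aq)).
have dS i j : differentiable (fun z => vAm1 z i j : R) q.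
  by have [] := is_diffmx_vAm1 i j.
have [dA Aq0] : exists dA, is_diffmx q (fun z => (\det (vAm1 z))^-1 *:
    ((\tr (vAm1 z))%:M - vAm1 z)) dA.
  apply: is_diffmx_differentiable => i j.
  rewrite (_ : (fun z => _) = (fun z =>
    (vAm1 z 0 0 * vAm1 z 1 1 - vAm1 z 0 1 * vAm1 z 1 0)^-1
      * ((vAm1 z 0 0 + vAm1 z 1 1) * (i == j)%:R - vAm1 z i j))); last first.
    by apply/funext => z; rewrite !mxE mulr_natr det2 tr2.
  apply: differentiableM.
    apply: differentiableV; last by rewrite -det2.
    by apply: differentiableB; apply: differentiableM.
  apply: differentiableB => //; apply: differentiableM (differentiable_cst _ _).
  exact: differentiableD.
have Aq : is_diffmx q (@vA R) dA.
  apply: is_diffmx_near Aq0; apply: filterS near_admissible => z az.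
  by rewrite /vA invmx2 // vAm1_unit.
apply: is_diffmx_change (Aq) _ => d; rewrite /dvA.
have AS : is_diffmx q (fun z => vA z *m vAm1 z) (fun=> 0).
  apply: is_diffmx_near (is_diffmx_const q 1%:M).
  by apply: filterS near_admissible => z az; rewrite vA_vAm1.
have := is_diffmx_unique AS (is_diffmx_mul Aq is_diffmx_vAm1) d.
move/(congr1 (mulmx^~ (vA q))); rewrite mul0mx mulmxDl -(mulmxA (dA d)) vAm1_vA //.
by rewrite mulmx1 => /esym/eqP; rewrite addr_eq0 => /eqP.
Qed.

End AtAdmissible.
End Derivatives.

Section FluxDerivatives.
Context {R : realType}.
Variables g G : R.
Implicit Types (q d : 'rV[R]_11) (j : 'I_2).

(** Half the gradient of [tr (F A F^T)] in [F] at fixed symmetric [A]. *)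
Definition vZ q : 'M[R]_2 := vF q *m vA q.
Definition dvZ q d : 'M[R]_2 := dvF q d *m vA q + vF q *m dvA q d.

Definition pressure q : R := g / 2 * cH q ^+ 2 + G * cH q ^+ 3 * vAcc q.
(** The partial derivatives of the pressure are taken in the independent variables [h] and [c], with
    [A_cc = c^4]. *)
Definition pressure_H q : R := g * cH q + 3 * G * cH q ^+ 2 * vAcc q.
Definition pressure_c q : R := 4 * G * cH q ^+ 3 * vAcc14 q ^+ 3.
Definition dpressure q d : R := pressure_H q * cH d + pressure_c q * dvAcc14 q d.

Definition dstress q d : 'M[R]_2 :=
  (dpressure q d)%:M - ((G * cH q) *: (dvZ q d *m (vF q)^T + vZ q *m (dvF q d)^T)
                        + (G * cH d) *: (vZ q *m (vF q)^T)).

Definition dHU j q d : R := cH q * dvU q d j 0 + vU q j 0 * cH d.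

Definition dflux j q d : 'rV[R]_11 :=
  cvars (dHU j q d)
        ((cH q * vU q j 0) *: dvU q d + dHU j q d *: vU q + col j (dstress q d))
        ((cH q * vU q j 0) *: dvF q d + dHU j q d *: vF q
         - (cH q *: (dvU q d *m row j (vF q) + vU q *m row j (dvF q d))
            + cH d *: (vU q *m row j (vF q))))
        (cH q * vU q j 0 * dvAcc14 q d + vAcc14 q * dHU j q d)
        ((cH q * vU q j 0) *: dvAm2 q d + dHU j q d *: vAm2 q).

(** Differential of the energy per unit mass, [entropy g G q / cH q]. *)
Definition denergy q d : R :=
  \sum_i vU q i 0 * dvU q d i 0 + g / 2 * cH d
  + G / 2 * (\tr (dvZ q d *m (vF q)^T + vZ q *m (dvF q d)^T)
             + 2 * cH q * vAcc q * cH d + 4 * cH q ^+ 2 * vAcc14 q ^+ 3 * dvAcc14 q d).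

Definition dentropy q d : R := entropy g G q / cH q * cH d + cH q * denergy q d.

Definition dentropy_flux j q d : R :=
  entropy g G q * dvU q d j 0 + vU q j 0 * dentropy q d
  + (dstress q d *m vU q + pressure_stress g G q *m dvU q d) j 0.

Section AtAdmissible.
Variable q : 'rV[R]_11.
Hypothesis aq : admissible R q.

Lemma is_diffmx_vZ : is_diffmx q vZ (dvZ q).
Proof. exact: is_diffmx_mul (is_diffmx_vF aq) (is_diffmx_vA aq). Qed.

Lemma is_diff_pressure : is_diff q pressure (dpressure q).
Proof.
have hq := is_diff_cH q; have cq := is_diff_vAcc14 aq.
apply: is_diff_change (is_diff_add
  (is_diff_mul (is_diff_const q (g / 2)) (is_diff_pow 1 hq))
  (is_diff_mul (is_diff_mul (is_diff_const q G) (is_diff_pow 2 hq))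
               (is_diff_pow 3 cq))) _ => d.
rewrite /dpressure /pressure_H /pressure_c /vAcc; by field.
Qed.

Lemma is_diffmx_scalar n (f df : 'rV[R]_11 -> R) : is_diff q f df ->
  is_diffmx q (fun z => (f z)%:M : 'M[R]_n) (fun d => (df d)%:M).
Proof.
move=> fq; have D := is_diffmx_scale fq (is_diffmx_const q (1%:M : 'M[R]_n)).
apply: is_diffmx_ext (is_diffmx_change D _) => [z | d]; first by rewrite scalemx1.
by rewrite scaler0 add0r scalemx1.
Qed.

Lemma is_diffmx_stress : is_diffmx q (pressure_stress g G) (dstress q).
Proof.
have Zq := is_diffmx_mul is_diffmx_vZ (is_diffmx_tr (is_diffmx_vF aq)).
have hq := is_diff_mul (is_diff_const q G) (is_diff_cH q).
have D := is_diffmx_add (is_diffmx_scalar (n := 2) is_diff_pressure)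
  (is_diffmx_opp (is_diffmx_scale hq Zq)).
apply: is_diffmx_ext (is_diffmx_change D _) => // d.
by rewrite /dstress mulr0 addr0.
Qed.

Lemma is_diff_HU j : is_diff q (fun z => cH z * vU z j 0) (dHU j q).
Proof. exact: is_diff_mul (is_diff_cH q) (is_diffmx_vU aq j 0). Qed.

Lemma is_diffmx_row m n (f df : 'rV[R]_11 -> 'M[R]_(m, n)) i : is_diffmx q f df ->
  is_diffmx q (fun z => row i (f z)) (fun d => row i (df d)).
Proof.
move=> fq k l; rewrite (_ : (fun z => _) = (fun z => f z i l)).
  by apply: is_diff_change (fq i l) _ => d; rewrite mxE.
by apply/funext => z; rewrite mxE.
Qed.

Lemma is_diffmx_col m n (f df : 'rV[R]_11 -> 'M[R]_(m, n)) i : is_diffmx q f df ->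
  is_diffmx q (fun z => col i (f z)) (fun d => col i (df d)).
Proof.
move=> fq k l; rewrite (_ : (fun z => _) = (fun z => f z k i)).
  by apply: is_diff_change (fq k i) _ => d; rewrite mxE.
by apply/funext => z; rewrite mxE.
Qed.

Lemma is_diffmx_cvars fh dh fm dm fM dM fc dc fY dY :
  is_diff q (fh : _ -> R) (dh : _ -> R) -> is_diffmx q fm dm -> is_diffmx q fM dM ->
  is_diff q (fc : _ -> R) (dc : _ -> R) -> is_diffmx q fY dY ->
  is_diffmx q (fun z => cvars (fh z) (fm z) (fM z) (fc z) (fY z))
    (fun d => cvars (dh d) (dm d) (dM d) (dc d) (dY d)).
Proof.
move=> Hh Hm HM Hc HY i k.
have e (P : 'rV[R]_11 -> 'rV[R]_11) (Q : 'rV[R]_11 -> R) :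
    (forall z, P z 0 k = Q z) -> (fun z => P z i k) = Q.
  by move=> E; apply/funext => z; rewrite ord1.
case: k e => [[|[|[|[|[|[|[|[|[|[|[|//]]]]]]]]]]] lk] e;
  rewrite (e (fun d => cvars (dh d) (dm d) (dM d) (dc d) (dY d)) _
     (fun z => mxE _ _ _ _)) (e (fun d => cvars (fh d) (fm d) (fM d) (fc d) (fY d)) _
     (fun z => mxE _ _ _ _)) //=.
Qed.

Lemma is_diffmx_flux j : is_diffmx q (flux g G j) (dflux j q).
Proof.
have hq := is_diff_cH q; have cq := is_diff_vAcc14 aq.
have aj := is_diff_HU j; have Uq := is_diffmx_vU aq; have Fq := is_diffmx_vF aq.
apply: is_diffmx_cvars => //.
- exact: is_diffmx_add (is_diffmx_scale aj Uq) (is_diffmx_col j is_diffmx_stress).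
- apply: is_diffmx_ext (is_diffmx_add (is_diffmx_scale aj Fq) (is_diffmx_opp
    (is_diffmx_scale hq (is_diffmx_mul Uq (is_diffmx_row j Fq))))) => z.
  by apply/matrixP => i a; rewrite !mxE big_ord1 !mxE; ring.
- exact: is_diff_mul aj cq.
- exact: is_diffmx_scale aj (is_diffmx_vAm2 aq).
Qed.

Lemma is_diff_entropy : is_diff q (entropy g G) (dentropy q).
Proof.
have hq := is_diff_cH q; have cq := is_diff_vAcc14 aq; have Uq := is_diffmx_vU aq.
have tq := is_diff_trace (is_diffmx_mul is_diffmx_vZ (is_diffmx_tr (is_diffmx_vF aq))).
have Kq := is_diff_bigsum (fun i => is_diff_pow 1 (Uq i 0)).
have D := is_diff_mul hq (is_diff_add
  (is_diff_mul (is_diff_add Kq (is_diff_mul (is_diff_const q g) hq))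
    (is_diff_const q 2^-1))
  (is_diff_mul (is_diff_const q (G / 2)) (is_diff_add tq
    (is_diff_mul (is_diff_pow 1 hq) (is_diff_pow 3 cq))))).
apply: is_diff_change D _ => d.
rewrite /dentropy /denergy /entropy /vAcc -/(vZ q).
rewrite !sum2; move: (\tr _) (\tr _) => t1 t2; field; exact: cH_neq0.
Qed.

Lemma is_diff_entropy_flux j : is_diff q (entropy_flux g G j) (dentropy_flux j q).
Proof.
have Uq := is_diffmx_vU aq.
have D := is_diff_add (is_diff_mul is_diff_entropy (Uq j 0))
  (is_diffmx_mul is_diffmx_stress Uq j 0).
by apply: is_diff_change D _ => d.
Qed.

End AtAdmissible.
End FluxDerivatives.

(** * Companion law *)

Section DivergenceOfFlux.
Context {R : realType}.
Variables (g G : R) (q : 'rV[R]_11) (D : 'I_2 -> 'rV[R]_11).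
Hypothesis aq : admissible R q.
Hypothesis piola : forall a, \sum_j cHF (D j) j a = 0.

(** When [D j] is the [j]-th spatial derivative of a field, [X] is the divergence of its flux, hence
    minus its time derivative in the absence of sources. Evaluating the differentials at [X] thus
    yields the equations in advective form. *)
Let X := \sum_j dflux g G j q (D j).

Lemma cHF_dvF d : cHF d = cH q *: dvF q d + cH d *: vF q.
Proof. by rewrite /dvF scalerKV ?cH_neq0 // subrK. Qed.

(** Piola's identities with the product rule applied to [H F], in the form used for both the [F_h]
    and the momentum equations. *)
Lemma piola_row : \sum_j (cH q *: row j (dvF q (D j)) + cH (D j) *: row j (vF q)) = 0.
Proof.
apply/rowP => a; rewrite summxE [RHS]mxE -[RHS](piola a).
by apply: eq_bigr => j _; rewrite cHF_dvF !mxE.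
Qed.

Lemma cH_div : cH X = \sum_j dHU j q (D j).
Proof. by rewrite linear_sum /=; apply: eq_bigr => j _; rewrite cH_cvars. Qed.

Lemma dvAcc14_div : dvAcc14 q X = \sum_j vU q j 0 * dvAcc14 q (D j).
Proof.
rewrite /dvAcc14 cH_div [cHAcc14 _]linear_sum /= mulr_suml -sumrB mulr_suml.
apply: eq_bigr => j _; rewrite cHAcc14_cvars /dvAcc14; field; exact: cH_neq0.
Qed.

Lemma dvAm2_sym d : (dvAm2 q d)^T = dvAm2 q d.
Proof.
rewrite /dvAm2 [LHS]linearZ /= [(_ - _)^T]linearB /= [(_ *: _)^T]linearZ /=.
by rewrite cHAm2_sym vAm2_sym.
Qed.

Lemma dvAm2_div : dvAm2 q X = \sum_j vU q j 0 *: dvAm2 q (D j).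
Proof.
rewrite {1}/dvAm2 cH_div [cHAm2 _]linear_sum /= scaler_suml -sumrB scaler_sumr.
apply: eq_bigr => j _; rewrite cHAm2_cvars; last first.
  by rewrite [LHS]linearD /= ![(_ *: _)^T]linearZ /= dvAm2_sym vAm2_sym.
by rewrite addrK scalerA mulKf ?cH_neq0.
Qed.

Lemma dvAm1_div : dvAm1 q X = \sum_j vU q j 0 *: dvAm1 q (D j).
Proof.
rewrite /dvAm1 dvAm2_div linear_sum /=; apply: eq_bigr => j _; exact: linearZ.
Qed.

Lemma dvA_div : dvA q X = \sum_j vU q j 0 *: dvA q (D j).
Proof.
rewrite /dvA dvAm1_div mulmx_sumr mulmx_suml -sumrN; apply: eq_bigr => j _.
by rewrite -scalemxAr -scalemxAl scalerN.
Qed.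

Lemma dvF_div : dvF q X =
  \sum_j (vU q j 0 *: dvF q (D j) - dvU q (D j) *m row j (vF q)).
Proof.
apply: (scalerI (cH_neq0 aq)); rewrite {1}/dvF scalerKV ?cH_neq0 //.
rewrite cH_div [cHF _]linear_sum /= scaler_suml -sumrB scaler_sumr.
(* [U] times Piola's identity: it removes the terms of [d_j (H F^j U)] in which the derivative falls
   on [H F^j]. *)
have P0 : \sum_j vU q *m (cH q *: row j (dvF q (D j)) + cH (D j) *: row j (vF q)) = 0.
  by rewrite -mulmx_sumr piola_row mulmx0.
rewrite -[RHS]subr0 -[X in _ = _ - X]P0 -sumrB.
apply: eq_bigr => j _; rewrite cHF_cvars mulmxDr -!scalemxAr.
move: (_ *m row j (vF q)) (_ *m row j (vF q)) (_ *m row j (dvF _ _)) => P Q S.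
move: (dvF _ _) (vF _) => Fd F.
by apply/matrixP => i a; rewrite !mxE; ring.
Qed.

Lemma dvZ_div : dvZ q X =
  \sum_j (vU q j 0 *: dvZ q (D j) - dvU q (D j) *m row j (vZ q)).
Proof.
rewrite /dvZ dvF_div dvA_div mulmx_suml mulmx_sumr -big_split /=.
apply: eq_bigr => j _; rewrite mulmxBl scalerDr -scalemxAl -scalemxAr row_mul mulmxA.
by rewrite addrAC.
Qed.

Lemma col_dstress j d : col j (dstress g G q d) = dpressure g G q d *: delta_mx j 0
  - ((G * cH q) *: (dvZ q d *m (row j (vF q))^T + vZ q *m (row j (dvF q d))^T)
     + (G * cH d) *: (vZ q *m (row j (vF q))^T)).
Proof.
rewrite /dstress; move: (dvZ q d) (vF q) (vZ q) (dvF q d) => A B C E.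
apply/colP => i; rewrite !(mxE, sum2) eqxx andbT mulr_natr.
ring.
Qed.

Lemma dvU_div_stress : cH q *: dvU q X =
  \sum_j (cH q * vU q j 0 *: dvU q (D j) + col j (dstress g G q (D j))).
Proof.
rewrite {1}/dvU scalerKV ?cH_neq0 //.
rewrite cH_div [cHU _]linear_sum /= scaler_suml -sumrB.
by apply: eq_bigr => j _; rewrite cHU_cvars addrAC addrK.
Qed.

Lemma dvU_div : cH q *: dvU q X = \sum_j (cH q * vU q j 0 *: dvU q (D j)
  + dpressure g G q (D j) *: delta_mx j 0
  - (G * cH q) *: (dvZ q (D j) *m (row j (vF q))^T)).
Proof.
rewrite dvU_div_stress.
(* [G Z] times the transposed Piola identity removes the terms of the elastic stress in which the
   derivative falls on [H F]. *)
have P0 : \sum_j (G *: vZ q) *m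
    (cH q *: row j (dvF q (D j)) + cH (D j) *: row j (vF q))^T = 0.
  by rewrite -mulmx_sumr -linear_sum /= piola_row trmx0 mulmx0.
rewrite -[LHS]addr0 -[X in _ + X = _]P0 -big_split /=.
apply: eq_bigr => j _; rewrite col_dstress.
rewrite [(_ *: row _ _ + _)^T]linearD /= ![(_ *: row _ _)^T]linearZ /=.
rewrite mulmxDr -!scalemxAr -!scalemxAl.
move: (dvZ q (D j) *m _) (vZ q *m (row j (vF q))^T) (vZ q *m (row j (dvF _ _))^T).
move=> P Q S; apply/colP => i; rewrite !mxE; ring.
Qed.

Lemma lyap_sym (S T : 'M[R]_2) : S^T = S -> T^T = T -> (lyap S T)^T = lyap S T.
Proof.
move=> symS symT; rewrite /lyap [LHS]linearZ /= [(T + _)^T]linearD /=.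
by rewrite [(_ *: (_ *m _))^T]linearZ /= !trmx_mul trmx_inv symS symT mulmxA.
Qed.

Lemma dvA_sym d : (dvA q d)^T = dvA q d.
Proof.
rewrite /dvA [LHS]linearN /= !trmx_mul vA_sym // lyap_sym ?dvAm2_sym ?vAm1_sym //.
by rewrite mulmxA.
Qed.

Lemma vZ_vF_sym : (vZ q *m (vF q)^T)^T = vZ q *m (vF q)^T.
Proof. by rewrite /vZ !trmx_mul trmxK vA_sym // mulmxA. Qed.

Lemma dstress_sym d : (dstress g G q d)^T = dstress g G q d.
Proof.
rewrite /dstress [LHS]linearB /= tr_scalar_mx; congr (_ - _).
rewrite [LHS]linearD /= [(_ *: (_ + _))^T]linearZ [(_ *: (_ *m _))^T]linearZ /=.
rewrite vZ_vF_sym; congr (_ *: _ + _).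
rewrite /dvZ /vZ [LHS]linearD /= !trmx_mul trmxK [(_ + _)^T]linearD /= !trmx_mul.
rewrite vA_sym // dvA_sym // !mulmxDl !mulmxDr !mulmxA.
by rewrite trmxK addrC [X in _ + X = _]addrC addrA.
Qed.

(** The stretching parts of [D_t Z] and [D_t F] each produce the contraction of [F A F^T] with the
    velocity gradient; they are equal because [Z F^T] is symmetric. *)
Lemma trace_div : \tr (dvZ q X *m (vF q)^T + vZ q *m (dvF q X)^T) =
  \sum_j (vU q j 0 * \tr (dvZ q (D j) *m (vF q)^T + vZ q *m (dvF q (D j))^T)
          - 2 * (vZ q *m (vF q)^T *m dvU q (D j)) j 0).
Proof.
rewrite dvZ_div dvF_div mulmx_suml linear_sum mulmx_sumr -big_split linear_sum /=.
apply: eq_bigr => j _.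
have := vZ_vF_sym; move: (dvZ _ _) (vF q) (vZ q) (dvF _ _) (dvU _ _) => A B C E u.
move=> sym.
have E0 i : (C *m (row j B)^T) i 0 = (C *m B^T) j i.
  by rewrite -sym [RHS]mxE !mulmx2 !mxE.
rewrite mulmxBl [(_ - _)^T]linearB mulmxBr /= !mxtraceD.
rewrite !raddfN /= -scalemxAl mxtraceZ [(_ *: E)^T]linearZ -scalemxAr mxtraceZ.
have -> : \tr (u *m row j C *m B^T) = (C *m B^T *m u) j 0.
  by rewrite -mulmxA mxtrace_mulC trace_mx11 -!row_mul mxE.
have -> : \tr (C *m (u *m row j B)^T) = (C *m B^T *m u) j 0.
  rewrite trmx_mul mulmxA mxtrace_mulC trace_mx11 [LHS]mulmx2 [RHS]mulmx2 !E0.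
  by rewrite [u^T 0 0]mxE [u^T 0 1]mxE; ring.
ring.
Qed.

(** Momentum tested against [U] gives [U] times the divergence of the stress, and the internal
    energy gives the stress contracted with the velocity gradient. Together they form the divergence
    of the stress applied to [U]. *)
Lemma entropy_balance :
  dentropy g G q X = \sum_j dentropy_flux g G j q (D j).
Proof.
have h0 := cH_neq0 aq.
(* Kinetic energy. The symmetry of [dstress] allows [U] to be contracted with the other index. *)
have EU : cH q * (\sum_i vU q i 0 * dvU q X i 0) =
  \sum_j (cH q * vU q j 0 * (\sum_i vU q i 0 * dvU q (D j) i 0)
    + (dstress g G q (D j) *m vU q) j 0).
  rewrite mulr_sumr.
  transitivity (\sum_i vU q i 0 * (cH q *: dvU q X) i 0).
    apply: eq_bigr => i _; move: (vU q) (dvU q X) => w u.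
    by rewrite mxE mulrCA.
  rewrite dvU_div_stress.
  under eq_bigr => i _ do rewrite summxE mulr_sumr.
  rewrite exchange_big /=; apply: eq_bigr => j _.
  have := dstress_sym (D j); move: (dstress _ _ _ _) (vU q) (dvU _ _) => T w u symT.
  have Tj i : T j i = T i j by rewrite -{1}symT mxE.
  by rewrite mulmx2 !sum2 !mxE !Tj; ring.
rewrite /dentropy /denergy trace_div dvAcc14_div cH_div !mulrDr EU.
rewrite !(mulr_sumr, mulr_suml) -!big_split /=; apply: eq_bigr => j _.
rewrite /dentropy_flux /dentropy /denergy /dHU.
have -> : pressure_stress g G q *m dvU q (D j) = pressure g G q *: dvU q (D j)
    - (G * cH q) *: (vZ q *m (vF q)^T *m dvU q (D j)).
  by rewrite /pressure_stress -/(vZ q) mulmxBl mul_scalar_mx -scalemxAl.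
move: (\sum_i _) (\tr _) (_ *m _ *m dvU _ _) (_ *m vU _) => K t w s.
rewrite !mxE /pressure; field; exact: h0.
Qed.

End DivergenceOfFlux.

(** * Symmetric form *)

Section DotProduct.
Context {R : realType}.

Lemma cvars_dot (h : R) m M c Y (w : 'rV[R]_11) :
  (cvars h m M c Y *m w^T) 0 0 = h * cH w + \sum_i m i 0 * cHU w i 0
    + \tr (M *m (cHF w)^T) + c * cHAcc14 w
    + (Y 0 0 * cHAm2 w 0 0 + Y 0 1 * cHAm2 w 0 1 + Y 1 1 * cHAm2 w 1 1).
Proof.
rewrite -{1}(cvarsK w); move: (cH w) (cHU w) (cHF w) (cHAcc14 w) (cHAm2 w).
move=> h' m' M' c' Y'; rewrite sum2 tr2 mxE.
under eq_bigr => k _ do rewrite !mxE.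
by rewrite !big_ord_recl big_ord0 /= !mxE !sum2 !mxE; ring.
Qed.

(** The entries of the matrix are the values of the form at pairs of basis rows. *)
Lemma lin1_mx_sym n (f : 'rV[R]_n -> 'rV[R]_n) :
  (forall u v, (f u *m v^T) 0 0 = (f v *m u^T) 0 0) -> (lin1_mx f)^T = lin1_mx f.
Proof.
move=> sym; apply/matrixP => i j.
have E (u : 'rV[R]_n) (k : 'I_n) :
    u 0 k = (u *m (delta_mx 0 k : 'rV[R]_n)^T) 0 0.
  rewrite mxE (bigD1 k) //= big1 => [|l lk]; first by rewrite !mxE !eqxx mulr1 addr0.
  by rewrite !mxE (negPf lk) andbF mulr0.
by rewrite 2![LHS]mxE [RHS]mxE (E (f _)) sym -E.
Qed.

End DotProduct.

Section Symmetrizer.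
Context {R : realType}.
Variables g G : R.
Implicit Types (q d w : 'rV[R]_11) (j : 'I_2).

(* Differential of the variables (pressure, U, F_h A_h, A_cc^{1/4}, A_h^{-2}),
   in which the quasilinear system is symmetric. *)
Definition dsymvars q d : 'rV[R]_11 :=
  cvars (dpressure g G q d) (dvU q d) (dvZ q d) (dvAcc14 q d) (dvAm2 q d).

(** [symbol_t] and [symbol_x] are the coefficients of the symmetric system in the blocks
    [(p, U, Z, c, A_h^-2)], kept as maps on blocks so that symmetry can be checked blockwise. The
    couplings of [p] with [U] and of [U] with [Z] occur in transposed pairs. *)
Definition symbol_t q w : 'rV[R]_11 :=
  cvars (cH w / (cH q * pressure_H g G q)) (cH q *: cHU w)
        ((G * cH q) *: (cHF w *m vAm1 q)) (cHAcc14 w) (cHAm2 w).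

Definition symbol_x j q w : 'rV[R]_11 :=
  cvars (vU q j 0 * cH w / (cH q * pressure_H g G q) + cHU w j 0)
        ((cH q * vU q j 0) *: cHU w + cH w *: delta_mx j 0
         - (G * cH q) *: (cHF w *m (row j (vF q))^T))
        ((G * cH q * vU q j 0) *: (cHF w *m vAm1 q)
         - (G * cH q) *: (cHU w *m row j (vF q)))
        (vU q j 0 * cHAcc14 w)
        (vU q j 0 *: cHAm2 w).

Fact dsymvars_is_linear q : linear (dsymvars q).
Proof.
move=> a u v; rewrite /dsymvars -cvars_linear.
have eU : dvU q (a *: u + v) = a *: dvU q u + dvU q v.
  rewrite /dvU [cHU (_ + _)]linearP [cH (_ + _)]linearP /=.
  move: (vU q) (cHU u) (cHU v) => F x y.
  by apply/matrixP => i k; rewrite !mxE; ring.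
have eF : dvF q (a *: u + v) = a *: dvF q u + dvF q v.
  rewrite /dvF [cHF (_ + _)]linearP [cH (_ + _)]linearP /=.
  move: (vF q) (cHF u) (cHF v) => F x y.
  by apply/matrixP => i k; rewrite !mxE; ring.
have eY : dvAm2 q (a *: u + v) = a *: dvAm2 q u + dvAm2 q v.
  rewrite /dvAm2 [cHAm2 (_ + _)]linearP [cH (_ + _)]linearP /=.
  move: (vAm2 q) (cHAm2 u) (cHAm2 v) => F x y.
  by apply/matrixP => i k; rewrite !mxE; ring.
have eA : dvA q (a *: u + v) = a *: dvA q u + dvA q v.
  rewrite /dvA /dvAm1 eY [lyap _ (_ + _)]linearP mulmxDr mulmxDl opprD.
  by rewrite -scalemxAr -scalemxAl scalerN.
have ec : dvAcc14 q (a *: u + v) = a * dvAcc14 q u + dvAcc14 q v.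
  by rewrite /dvAcc14 [cHAcc14 (_ + _)]linearP [cH (_ + _)]linearP /=; ring.
congr cvars => //.
  by rewrite /dpressure ec [cH (_ + _)]linearP /=; ring.
rewrite /dvZ eF eA mulmxDl mulmxDr -scalemxAl -scalemxAr scalerDr.
by rewrite addrACA.
Qed.

Fact symbol_t_is_linear q : linear (symbol_t q).
Proof.
move=> a u v; rewrite /symbol_t -cvars_linear.
rewrite [cH (_ + _)]linearP [cHU (_ + _)]linearP [cHF (_ + _)]linearP.
rewrite [cHAcc14 (_ + _)]linearP [cHAm2 (_ + _)]linearP /=.
congr cvars.
- by rewrite mulrDl mulrA.
- by rewrite scalerDr !scalerA mulrC.
- by rewrite mulmxDl -scalemxAl scalerDr !scalerA [a * _]mulrC.
Qed.

Fact symbol_x_is_linear j q : linear (symbol_x j q).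
Proof.
move=> a u v; rewrite /symbol_x -cvars_linear.
rewrite [cH (_ + _)]linearP [cHU (_ + _)]linearP [cHF (_ + _)]linearP.
rewrite [cHAcc14 (_ + _)]linearP [cHAm2 (_ + _)]linearP /=.
move: (cHU u) (cHU v) (cHF u) (cHF v) (cHAm2 u) (cHAm2 v) (vU q j 0) (vF q).
move=> U U' F F' Y Y' Uj B; congr cvars.
- by rewrite !mxE; ring.
- rewrite mulmxDl -scalemxAl; move: (F *m _) (F' *m _) => P P'.
  by apply/matrixP => i k; rewrite !mxE; ring.
- rewrite !mulmxDl -!scalemxAl.
  move: (F *m _) (F' *m _) (U *m _) (U' *m _) => P P' T T'.
  by apply/matrixP => i k; rewrite !mxE; ring.
- ring.
- by apply/matrixP => i k; rewrite !mxE; ring.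
Qed.

End Symmetrizer.

HB.instance Definition _ (R : realType) (g G : R) q := GRing.isLinear.Build
  R 'rV[R]_11 'rV[R]_11 *:%R (dsymvars g G q) (dsymvars_is_linear g G q).
HB.instance Definition _ (R : realType) (g G : R) q := GRing.isLinear.Build
  R 'rV[R]_11 'rV[R]_11 *:%R (symbol_t g G q) (symbol_t_is_linear g G q).
HB.instance Definition _ (R : realType) (g G : R) j q := GRing.isLinear.Build
  R 'rV[R]_11 'rV[R]_11 *:%R (symbol_x g G j q) (symbol_x_is_linear g G j q).

Section SymmetricForm.
Context {R : realType}.
Variables g G : R.
Hypotheses (g0 : 0 < g) (G0 : 0 < G).
Implicit Types (q d w : 'rV[R]_11) (j : 'I_2).

(** With [L = dsymvars g G q] and matrices acting on rows from the right, this is the matrix of the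
    form sending [(u, v)] to the dot product of [f q (L u)] with [L v]; symmetry passes from [f] to
    it, and so does positivity when [L] is injective. *)
Definition symmetrize (f : 'rV[R]_11 -> 'rV[R]_11 -> 'rV[R]_11) q : 'M[R]_11 :=
  lin1_mx (dsymvars g G q) *m lin1_mx (f q) *m (lin1_mx (dsymvars g G q))^T.

Lemma pressure_H_gt0 q : admissible R q -> 0 < pressure_H g G q.
Proof.
move=> aq; have h0 := cH_gt0 aq; have c0 : 0 < vAcc q by exact: exprn_gt0 (vAcc14_gt0 aq).
apply: addr_gt0; first exact: mulr_gt0.
apply: mulr_gt0 => //; apply: mulr_gt0; last exact: exprn_gt0.
by rewrite mulr_gt0 ?ltr0n.
Qed.

Lemma symmetrize_sym f q : (forall u v, (f q u *m v^T) 0 0 = (f q v *m u^T) 0 0) ->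
  (symmetrize f q)^T = symmetrize f q.
Proof.
by move=> sym; rewrite /symmetrize !trmx_mul trmxK (lin1_mx_sym sym) mulmxA.
Qed.

Lemma symbol_t_sym q (u v : 'rV[R]_11) : admissible R q ->
  (symbol_t g G q u *m v^T) 0 0 = (symbol_t g G q v *m u^T) 0 0.
Proof.
move=> aq; rewrite !cvars_dot -!scalemxAl !mxtraceZ.
have -> : \tr (cHF u *m vAm1 q *m (cHF v)^T) = \tr (cHF v *m vAm1 q *m (cHF u)^T).
  by rewrite -mxtrace_tr !trmx_mul trmxK vAm1_sym // mulmxA.
rewrite !sum2; move: (cHU u) (cHU v) (cHAm2 u) (cHAm2 v) (\tr _) => U V Y Z t.
by rewrite !mxE; ring.
Qed.

Lemma symbol_x_sym j q (u v : 'rV[R]_11) : admissible R q ->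
  (symbol_x g G j q u *m v^T) 0 0 = (symbol_x g G j q v *m u^T) 0 0.
Proof.
move=> aq; rewrite !cvars_dot !mulmxBl -!scalemxAl !raddfB /= !mxtraceZ.
have -> : \tr (cHF u *m vAm1 q *m (cHF v)^T) = \tr (cHF v *m vAm1 q *m (cHF u)^T).
  by rewrite -mxtrace_tr !trmx_mul trmxK vAm1_sym // mulmxA.
(* The couplings of the velocity block, in the shape that the pressure and [Z] blocks give once the
   two arguments are exchanged. *)
have E (x y : 'rV[R]_11) : \sum_i ((cH q * vU q j 0) *: cHU x + cH x *: delta_mx j 0
   - (G * cH q) *: (cHF x *m (row j (vF q))^T)) i 0 * cHU y i 0 =
   cH q * vU q j 0 * (\sum_i cHU x i 0 * cHU y i 0) + cH x * cHU y j 0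
   - (G * cH q) * \tr (cHU y *m row j (vF q) *m (cHF x)^T).
  rewrite mxtrace_mulC [(cHF x)^T *m _]mulmxA mxtrace_mulC trace_mx11 mulmx2.
  rewrite !sum2; move: (cHU x) (cHU y) (cHF x) (vU q) (vF q) => U V F W B.
  rewrite !(mxE, sum2) !eqxx andbT.
  case: (ord2P j) => -> /=; ring.
rewrite !E.
set t1 := \tr _; set t2 := \tr _; set t3 := \tr _.
have -> : \sum_i cHU v i 0 * cHU u i 0 = \sum_i cHU u i 0 * cHU v i 0.
  by apply: eq_bigr => i _; rewrite mulrC.
move: (\sum_i _) (cHU u j 0) (cHU v j 0) (vU q j 0) (cHAm2 u) (cHAm2 v).
move=> s x y z Y Z; rewrite !mxE; ring.
Qed.

Lemma symbol_t_posdef q w : admissible R q -> w != 0 ->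
  0 < (symbol_t g G q w *m w^T) 0 0.
Proof.
move=> aq; apply: contraNT; rewrite -leNgt cvars_dot -scalemxAl mxtraceZ.
have h0 := cH_gt0 aq; have p0 := pressure_H_gt0 aq.
have pos (a x : R) : 0 < a -> 0 <= x -> 0 <= a * x /\ (a * x = 0 -> x = 0).
  move=> a0 x0; split; first by rewrite mulr_ge0 // ltW.
  by move/eqP; rewrite mulf_eq0 gt_eqF //= => /eqP.
have sq0 (x : R) : x ^+ 2 = 0 -> x = 0 by move/eqP; rewrite sqrf_eq0 => /eqP.
have [p1 e1] := pos (cH q * pressure_H g G q)^-1 (cH w ^+ 2)
  ltac:(by rewrite invr_gt0 mulr_gt0) (sqr_ge0 _).
have [p2 e2] := pos _ _ h0 (tr_mul_tr_ge0 (cHU w)^T).1.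
have [p3 e3] := pos _ _ (mulr_gt0 G0 h0)
  (tr_posdef_ge0 (cHF w) (vAm1_posdef aq)).1.
have -> : cH w / (cH q * pressure_H g G q) * cH w =
  (cH q * pressure_H g G q)^-1 * cH w ^+ 2 by rewrite mulrAC mulrC expr2.
have -> : \sum_i (cH q *: cHU w) i 0 * cHU w i 0 =
  cH q * \tr ((cHU w)^T *m ((cHU w)^T)^T).
  rewrite trace_mx11 mulmx2 sum2; move: (cHU w) => U; rewrite !mxE; ring.
rewrite -!expr2 le_eqVlt ltNge !addr_ge0 ?sqr_ge0 // orbF.
rewrite !paddr_eq0 ?addr_ge0 ?sqr_ge0 // -!andbA.
case/and5P => /eqP t1 /eqP t2 /eqP t3 /eqP t4 /and3P[/eqP y1 /eqP y2 /eqP y3].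
apply/eqP/blocks_eq; rewrite linear0.
- exact/sq0/e1.
- apply/eqP; rewrite -(inj_eq (@trmx_inj _ _ _)) trmx0 -(tr_mul_tr_ge0 _).2 eq_sym.
  exact/eqP/e2.
- by apply/eqP; rewrite -(tr_posdef_ge0 _ (vAm1_posdef aq)).2 eq_sym; exact/eqP/e3.
- exact: sq0.
- apply: matrix2P; rewrite [RHS]mxE; [exact: sq0 | exact: sq0 | | exact: sq0].
  by rewrite (sym2 (cHAm2_sym w)); exact: sq0.
Qed.

(** The change of variables is triangular: [U], [c] and [A_h^-2] are read off, then [h] from the
    pressure since [pressure_H] is positive, then [F] from [Z = F A] since [A] is invertible. *)
Lemma dsymvars_inj q d : admissible R q -> dsymvars g G q d = 0 -> d = 0.
Proof.
move=> aq E; have h0 := cH_neq0 aq.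
have eY : dvAm2 q d = 0.
  have := congr1 (@cHAm2 R) E; rewrite linear0 cHAm2_cvars //; exact: dvAm2_sym.
have ec : dvAcc14 q d = 0 by have := congr1 (@cHAcc14 R) E; rewrite linear0 cvarsE.
have eU : dvU q d = 0 by have := congr1 (@cHU R) E; rewrite linear0 cvarsE.
have eZ : dvZ q d = 0 by have := congr1 (@cHF R) E; rewrite linear0 cvarsE.
have eh : cH d = 0.
  have := congr1 (@cH R) E; rewrite linear0 cvarsE /dpressure ec mulr0 addr0.
  by move/eqP; rewrite mulf_eq0 gt_eqF ?pressure_H_gt0 //= => /eqP.
have eF : dvF q d = 0.
  move: eZ; rewrite /dvZ /dvA /dvAm1 eY linear0 mulmx0 mul0mx oppr0 mulmx0 addr0.
  by move/(congr1 (mulmx^~ (vAm1 q))); rewrite -mulmxA vA_vAm1 // mulmx1 mul0mx.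
have Z m n (M : 'M[R]_(m, n)) : (cH q)^-1 *: M = 0 -> M = 0.
  by move/eqP; rewrite scaler_eq0 invr_eq0 (negPf h0) => /eqP.
apply: blocks_eq; rewrite linear0 //.
- by apply: Z; rewrite -eU /dvU eh scale0r subr0.
- by apply: Z; rewrite -eF /dvF eh scale0r subr0.
- move/eqP: ec; rewrite /dvAcc14 eh mul0r subr0 mulf_eq0 invr_eq0 (negPf h0) orbF.
  by move/eqP.
- by apply: Z; rewrite -eY /dvAm2 eh scale0r subr0.
Qed.

Lemma mul_symmetrize_t q d : d *m symmetrize (symbol_t g G) q =
  symbol_t g G q (dsymvars g G q d) *m (lin1_mx (dsymvars g G q))^T.
Proof. by rewrite /symmetrize !mulmxA !mul_rV_lin1. Qed.

Lemma mul_symmetrize_x j q d : d *m symmetrize (symbol_x g G j) q =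
  symbol_x g G j q (dsymvars g G q d) *m (lin1_mx (dsymvars g G q))^T.
Proof. by rewrite /symmetrize !mulmxA !mul_rV_lin1. Qed.

Lemma symmetrize_t_posdef q : admissible R q ->
  posdefmx (symmetrize (symbol_t g G) q).
Proof.
move=> aq v v0; rewrite mul_symmetrize_t -{2}[v]trmxK -mulmxA -trmx_mul mul_rV_lin1.
apply: symbol_t_posdef => //; apply: contra_neq v0 => /(dsymvars_inj aq).
by move/(congr1 trmx); rewrite trmxK trmx0.
Qed.

(** The blocks are the advective equations derived from Piola's identities. In the pressure block
    [c] is transported, so only the compression term of the mass equation contributes, and division
    by [h p_h] turns it into [div U]. *)
Lemma symbol_flux q (D : 'I_2 -> 'rV[R]_11) : admissible R q ->
  (forall a, \sum_j cHF (D j) j a = 0) ->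
  symbol_t g G q (dsymvars g G q (\sum_j dflux g G j q (D j))) =
  \sum_j symbol_x g G j q (dsymvars g G q (D j)).
Proof.
move=> aq piola; have h0 := cH_neq0 aq.
have p0 := lt0r_neq0 (pressure_H_gt0 aq).
apply: blocks_eq; rewrite [RHS]linear_sum /= /symbol_t ?cvarsE.
- rewrite {1}/dpressure dvAcc14_div // cH_div // mulr_sumr mulr_sumr.
  rewrite -big_split mulr_suml /=; apply: eq_bigr => j _.
  by rewrite /symbol_x !cvarsE /dHU /dpressure; field; rewrite p0.
- rewrite dvU_div //; apply: eq_bigr => j _.
  by rewrite /symbol_x /dsymvars !cvarsE.
- rewrite dvZ_div // mulmx_suml scaler_sumr; apply: eq_bigr => j _.
  rewrite /symbol_x /dsymvars !cvarsE mulmxBl -scalemxAl -mulmxA.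
  by rewrite -row_mul /vZ -mulmxA vA_vAm1 // mulmx1 scalerBr scalerA.
- rewrite dvAcc14_div //; apply: eq_bigr => j _.
  by rewrite /symbol_x /dsymvars !cvarsE.
- have sY d : (dvAm2 q d)^T = dvAm2 q d by exact: dvAm2_sym.
  rewrite cHAm2_cvars ?cHAm2_sym // /dsymvars cHAm2_cvars // dvAm2_div //.
  apply: eq_bigr => j _; rewrite /symbol_x !cHAm2_cvars //.
  by rewrite [LHS]linearZ /= sY.
Qed.

Lemma symmetrize_flux q (D : 'I_2 -> 'rV[R]_11) : admissible R q ->
  (forall a, \sum_j cHF (D j) j a = 0) ->
  (\sum_j dflux g G j q (D j)) *m symmetrize (symbol_t g G) q =
  \sum_j D j *m symmetrize (symbol_x g G j) q.
Proof.
move=> aq piola; rewrite mul_symmetrize_t symbol_flux // mulmx_suml.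
by apply: eq_bigr => j _; rewrite mul_symmetrize_x.
Qed.

End SymmetricForm.

(** * Continuity of the symmetrizer *)

Section Continuity.
Context {R : realType}.

Lemma continuous_mx (T : topologicalType) m n (f : T -> 'M[R]_(m, n)) x :
  (forall i j, {for x, continuous (fun z => f z i j)}) -> {for x, continuous f}.
Proof.
move=> fx A [P Px sPA].
apply: filterS (_ : \forall z \near x, forall i j, P i j (f z i j)).
  by move=> z Pz; apply: sPA.
by apply: filter_forall => i; apply: filter_forall => j; exact: fx.
Qed.

Lemma is_diffmx_continuous (V : normedModType R) (x : V) m n (f df : V -> 'M[R]_(m, n)) :
  is_diffmx x f df -> {for x, continuous f}.
Proof.
move=> fx; apply: continuous_mx => i j; have [dfx _] := fx i j.
exact: differentiable_continuous dfx.
Qed.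

Lemma is_diff_det2 (V : normedModType R) (x : V) (f df : V -> 'M[R]_2) :
  is_diffmx x f df -> exists d, is_diff x (fun z => \det (f z)) (d : V -> R).
Proof.
move=> fx; eexists; rewrite (_ : (fun z => _) =
  (fun z => f z 0 0 * f z 1 1 + - (f z 0 1 * f z 1 0))); last first.
  by apply/funext => z; rewrite det2.
exact: is_diff_add (is_diff_mul (fx 0 0) (fx 1 1))
    (is_diff_opp (is_diff_mul (fx 0 1) (fx 1 0))).
Qed.

Variables g G : R.
Hypotheses (g0 : 0 < g) (G0 : 0 < G).
Variable q : 'rV[R]_11.
Hypothesis aq : admissible R q.

Lemma is_diff_pressure_H : exists d, is_diff q (pressure_H g G) d.
Proof.
have hq := is_diff_cH q; have cq := is_diff_vAcc14 aq.
eexists; exact: is_diff_add (is_diff_mul (is_diff_const q g) hq)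
  (is_diff_mul (is_diff_mul (is_diff_const q (3 * G)) (is_diff_pow 1 hq))
               (is_diff_pow 3 cq)).
Qed.

(** Continuity in the base point is obtained from differentiability, so the rules above apply and
    the differential may stay implicit. *)
Lemma is_diffmx_dsymvars (d : 'rV[R]_11) :
  exists e, is_diffmx q (fun z => dsymvars g G z d) e.
Proof.
have hq := is_diff_cH q; have cq := is_diff_vAcc14 aq.
have Uq := is_diffmx_vU aq; have Fq := is_diffmx_vF aq.
have Yq := is_diffmx_vAm2 aq; have Sq := is_diffmx_vAm1 aq; have Aq := is_diffmx_vA aq.
have hV := is_diff_inv (cH_neq0 aq) hq.
have dh := is_diff_const q (cH d).
have ratio m n (M : 'M[R]_(m, n)) f df (fq : is_diffmx q f df) := is_diffmx_scale hV
  (is_diffmx_add (is_diffmx_const q M) (is_diffmx_opp (is_diffmx_scale dh fq))).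
have dU := ratio _ _ (cHU d) _ _ Uq.
have dF := ratio _ _ (cHF d) _ _ Fq.
have dY := ratio _ _ (cHAm2 d) _ _ Yq.
have dc := is_diff_mul (is_diff_add (is_diff_const q (cHAcc14 d))
  (is_diff_opp (is_diff_mul dh cq))) hV.
have [eD detS] := is_diff_det2 Sq.
have t0 : 2 * \tr (vAm1 q) != 0.
  by rewrite mulf_neq0 ?pnatr_eq0 // gt_eqF // posdef_tr ?vAm1_sym //; exact: vAm1_posdef.
have tV := is_diff_inv (f := fun z => 2 * \tr (vAm1 z)) t0
  (is_diff_mul (is_diff_const q 2) (is_diff_trace Sq)).
(* This is [lyap (vAm1 z)] unfolded, [vA z] being the inverse of [vAm1 z]. *)
have dS := is_diffmx_scale tV (is_diffmx_add dY
  (is_diffmx_scale detS (is_diffmx_mul (is_diffmx_mul Aq dY) Aq))).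
have dA := is_diffmx_opp (is_diffmx_mul (is_diffmx_mul Aq dS) Aq).
have dZ := is_diffmx_add (is_diffmx_mul dF Aq) (is_diffmx_mul Fq dA).
have [ep pH] := is_diff_pressure_H.
have pc := is_diff_mul (is_diff_mul (is_diff_const q (4 * G)) (is_diff_pow 2 hq))
  (is_diff_pow 2 cq).
have dp := is_diff_add (is_diff_mul pH dh) (is_diff_mul pc dc).
eexists; exact: is_diffmx_cvars dp dU dZ dc dY.
Qed.

Lemma is_diffmx_lin1 n (f : 'rV[R]_11 -> 'rV[R]_n -> 'rV[R]_n) :
  (forall d, exists e, is_diffmx q (fun z => f z d) e) ->
  exists e, is_diffmx q (fun z => lin1_mx (f z)) e.
Proof.
move=> fq; apply: is_diffmx_differentiable => i j.
have [e [De _]] : exists e, is_diff q (fun z => f z (delta_mx 0 i) 0 j) e.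
  by have [e /(_ 0 j)] := fq (delta_mx 0 i); eexists; eassumption.
rewrite (_ : (fun z => _) = (fun z => f z (delta_mx 0 i) 0 j)) //.
by apply/funext => z; rewrite mxE.
Qed.

Lemma is_diffmx_symbol_t w : exists e, is_diffmx q (fun z => symbol_t g G z w) e.
Proof.
have hq := is_diff_cH q; have Sq := is_diffmx_vAm1 aq.
have [ep pH] := is_diff_pressure_H.
have hp0 : cH q * pressure_H g G q != 0.
  by rewrite mulf_neq0 ?cH_neq0 // gt_eqF // pressure_H_gt0.
have hpV := is_diff_inv (f := fun z => cH z * pressure_H g G z) hp0 (is_diff_mul hq pH).
have Gh := is_diff_mul (is_diff_const q G) hq.
eexists; exact: is_diffmx_cvars (is_diff_mul (is_diff_const q (cH w)) hpV)
  (is_diffmx_scale hq (is_diffmx_const q (cHU w)))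
  (is_diffmx_scale Gh (is_diffmx_mul (is_diffmx_const q (cHF w)) Sq))
  (is_diff_const q (cHAcc14 w)) (is_diffmx_const q (cHAm2 w)).
Qed.

Lemma is_diffmx_symbol_x j w : exists e, is_diffmx q (fun z => symbol_x g G j z w) e.
Proof.
have hq := is_diff_cH q; have Sq := is_diffmx_vAm1 aq.
have Uj := is_diffmx_vU aq j 0; have Fj := is_diffmx_row j (is_diffmx_vF aq).
have [ep pH] := is_diff_pressure_H.
have hp0 : cH q * pressure_H g G q != 0.
  by rewrite mulf_neq0 ?cH_neq0 // gt_eqF // pressure_H_gt0.
have hpV := is_diff_inv (f := fun z => cH z * pressure_H g G z) hp0 (is_diff_mul hq pH).
have Gh := is_diff_mul (is_diff_const q G) hq.
have ph := is_diff_add (is_diff_mul (is_diff_mul Uj (is_diff_const q (cH w))) hpV)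
  (is_diff_const q (cHU w j 0)).
have um := is_diffmx_add (is_diffmx_add
    (is_diffmx_scale (is_diff_mul hq Uj) (is_diffmx_const q (cHU w)))
    (is_diffmx_const q (cH w *: delta_mx j 0 : 'cV[R]_2)))
  (is_diffmx_opp (is_diffmx_scale Gh
     (is_diffmx_mul (is_diffmx_const q (cHF w)) (is_diffmx_tr Fj)))).
have Zm := is_diffmx_add
  (is_diffmx_scale (is_diff_mul Gh Uj) (is_diffmx_mul (is_diffmx_const q (cHF w)) Sq))
  (is_diffmx_opp (is_diffmx_scale Gh (is_diffmx_mul (is_diffmx_const q (cHU w)) Fj))).
eexists; exact: is_diffmx_cvars ph um Zm (is_diff_mul Uj (is_diff_const q (cHAcc14 w)))
  (is_diffmx_scale Uj (is_diffmx_const q (cHAm2 w))).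
Qed.

Lemma symmetrize_continuous f :
  (forall w, exists e, is_diffmx q (fun z => f z w) e) ->
  {for q, continuous (symmetrize g G f)}.
Proof.
move=> fq; have [eL Lq] := is_diffmx_lin1 is_diffmx_dsymvars.
have [ef Mq] := is_diffmx_lin1 fq.
exact: is_diffmx_continuous (is_diffmx_mul (is_diffmx_mul Lq Mq) (is_diffmx_tr Lq)).
Qed.

End Continuity.

(** * Chain rule and quasilinear form along smooth fields *)

Section ChainRule.
Context {R : realType}.
Variables (Q : spacetime R -> 'rV[R]_11) (p v : spacetime R).
Hypothesis dQ : differentiable Q p.

Lemma derive_scalar (f df : 'rV[R]_11 -> R) : is_diff (Q p) f df ->
  derivable (f \o Q : _ -> R^o) p v /\ 'D_v (f \o Q : _ -> R^o) p = df ('D_v Q p).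
Proof.
move=> [fq <-]; have dfQ : differentiable (f \o Q) p by exact: differentiable_comp.
split; first exact: diff_derivable dfQ.
by rewrite (deriveE _ dQ) (deriveE _ dfQ) diff_comp.
Qed.

Lemma derive_matrix m n (f df : 'rV[R]_11 -> 'M[R]_(m, n)) : is_diffmx (Q p) f df ->
  derivable (f \o Q) p v /\ 'D_v (f \o Q) p = df ('D_v Q p).
Proof.
move=> fq.
have dv : derivable (f \o Q) p v.
  by apply/derivable_mxP => i j; have [] := derive_scalar (fq i j).
split=> //; rewrite derive_mx //; apply/matrixP => i j; rewrite mxE.
by have [_] := derive_scalar (fq i j).
Qed.

End ChainRule.

Section SmoothFields.
Context {R : realType}.
Variables (g G : R) (O : set (spacetime R)) (Q : spacetime R -> 'rV[R]_11).
Hypothesis smooth : smooth_field O Q.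

Lemma smooth_field_diff p : O p -> differentiable Q p.
Proof. by case: smooth => _ C1 _ _ /C1 []. Qed.

Lemma smooth_field_admissible p : O p -> admissible R (Q p).
Proof. by case: smooth => _ _ sQ _ /sQ []. Qed.

Lemma smooth_field_piola p (a : 'I_2) : O p ->
  \sum_j cHF ('D_(dir_x j) Q p) j a = 0.
Proof.
move=> Op; have [_ _ _ piola] := smooth; rewrite -[RHS](piola p Op a).
apply: eq_bigr => j _.
by have [_ ->] := derive_scalar (dir_x j) (smooth_field_diff Op)
  (is_diffmx_cHF (Q p) j a).
Qed.

(** For a differentiable field of admissible states the derivability clauses of [balance_law] hold
    by the chain rule, which leaves only the quasilinear equation. *)
Lemma flux_balanceP s : balance_law O Q (fun j => flux g G j \o Q) s <->
  forall p, O p ->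
    'D_dir_t Q p + \sum_j dflux g G j (Q p) ('D_(dir_x j) Q p) = s p.
Proof.
have dF p j : O p -> derivable (flux g G j \o Q) p (dir_x j) /\
    'D_(dir_x j) (flux g G j \o Q) p = dflux g G j (Q p) ('D_(dir_x j) Q p).
  move=> Op; apply: derive_matrix; first exact: smooth_field_diff.
  exact: is_diffmx_flux (smooth_field_admissible Op) j.
have sumE p : O p -> \sum_(j < 2) 'D_(dir_x j) (flux g G j \o Q) p =
    \sum_j dflux g G j (Q p) ('D_(dir_x j) Q p).
  by move=> Op; apply: eq_bigr => j _; have [_ ->] := dF p j Op.
split=> H p Op; first by have [_ _ <-] := H p Op; rewrite sumE.
split; last by rewrite sumE // H.
- exact/diff_derivable/smooth_field_diff.
- by move=> j; have [] := dF p j Op.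
Qed.

Lemma entropy_companion :
  balance_law O Q (fun j => flux g G j \o Q) (fun=> 0) ->
  balance_law (V := R^o) O (entropy g G \o Q) (fun j => entropy_flux g G j \o Q)
    (fun=> 0).
Proof.
move/flux_balanceP => E p Op; have aq := smooth_field_admissible Op.
have dQ := smooth_field_diff Op.
have eta := is_diff_entropy g G aq.
have [d0 e0] := derive_scalar dir_t dQ eta.
have dF j := derive_scalar (dir_x j) dQ (is_diff_entropy_flux g G aq j).
split=> //; first by move=> j; have [] := dF j.
rewrite e0; under eq_bigr => j _ do rewrite (dF j).2.
rewrite -entropy_balance //; last by move=> a; exact: smooth_field_piola.
have /eqP := E p Op; rewrite addr_eq0 => /eqP ->.
(* [dentropy] is identified with a differential, hence is linear. *)
have [_ <-] := eta.
by rewrite linearN addNr.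
Qed.

End SmoothFields.

(** * Equivalence with the symmetric system *)

Section SymmetricHyperbolic.
Context {R : realType}.
Variables (g G lambda K : R).
Hypotheses (g0 : 0 < g) (G0 : 0 < G).

Lemma posdefmx_mul_eq0 n (S : 'M[R]_n) (u : 'rV[R]_n) :
  posdefmx S -> u *m S = 0 -> u = 0.
Proof.
move=> pS uS; apply: contraTeq isT => u0.
have /pS : u^T != 0 by rewrite -trmx0 (inj_eq (@trmx_inj _ _ _)).
by rewrite trmxK uS mul0mx mxE ltxx.
Qed.

Lemma svm_symmetric_hyperbolic : symmetric_hyperbolic g G lambda K.
Proof.
exists (symmetrize g G (symbol_t g G)), (fun j => symmetrize g G (symbol_x g G j)).
have symT q : admissible R q -> (symmetrize g G (symbol_t g G) q)^T =
    symmetrize g G (symbol_t g G) q.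
  by move=> aq; apply: symmetrize_sym => u v; exact: symbol_t_sym.
have symX j q : admissible R q -> (symmetrize g G (symbol_x g G j) q)^T =
    symmetrize g G (symbol_x g G j) q.
  by move=> aq; apply: symmetrize_sym => u v; exact: symbol_x_sym.
split.
- apply: continuous_in_subspaceT => q /set_mem aq.
  by apply: symmetrize_continuous => // w; exact: is_diffmx_symbol_t.
- move=> j; apply: continuous_in_subspaceT => q /set_mem aq.
  by apply: symmetrize_continuous => // w; exact: is_diffmx_symbol_x.
- by move=> q aq; split; [exact: symT | exact: symmetrize_t_posdef].
- by move=> j q aq; exact: symX.
move=> O Q sQ; rewrite (flux_balanceP g G sQ).
suff E p : O p ->
    'D_dir_t Q p + \sum_j dflux g G j (Q p) ('D_(dir_x j) Q p) = source lambda K (Q p) <->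
    symmetrize g G (symbol_t g G) (Q p) *m ('D_dir_t Q p)^T
    + \sum_(j < 2) symmetrize g G (symbol_x g G j) (Q p) *m ('D_(dir_x j) Q p)^T
    = symmetrize g G (symbol_t g G) (Q p) *m (source lambda K (Q p))^T.
  by split=> H p Op; apply/(E p Op)/H.
move=> Op; have aq := smooth_field_admissible sQ Op.
have piola a := smooth_field_piola sQ a Op.
(* By symmetry the column equation is the transpose of a row equation, to which [symmetrize_flux]
   applies. *)
have trE (S : 'M[R]_11) (u : 'rV[R]_11) : S^T = S -> S *m u^T = (u *m S)^T.
  by move=> symS; rewrite trmx_mul symS.
have -> : \sum_(j < 2) symmetrize g G (symbol_x g G j) (Q p) *m ('D_(dir_x j) Q p)^T
    = \sum_(j < 2) ('D_(dir_x j) Q p *m symmetrize g G (symbol_x g G j) (Q p))^T.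
  by apply: eq_bigr => j _; rewrite trE ?symX.
rewrite !trE ?symT // -linear_sum -linearD /= -symmetrize_flux // -mulmxDl.
split=> [-> // | /trmx_inj /eqP].
(* Conversely, the residual of the quasilinear equation is annihilated by the positive definite
   symmetrizer, so it is zero. *)
rewrite -subr_eq0 -mulmxBl => /eqP /posdefmx_mul_eq0 H.
by apply/eqP; rewrite -subr_eq0 H //; exact: symmetrize_t_posdef.
Qed.

End SymmetricHyperbolic.

Theorem proposition2p1 (R : realType) (g G lambda K : R)
    (hg : 0 < g) (hG : 0 < G) (hlambda : 0 < lambda) (hK : 0 <= K) :
  [/\ convex_set (admissible R),
      mathematical_entropy g G (entropy g G) (entropy_flux g G)
    & symmetric_hyperbolic g G lambda K].
Proof.
split; first exact: admissible_convex.
  split; first exact: entropy_convex.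
    by move=> q sq; exact: entropy_strictly_convex.
  by move=> O Q sQ; exact: entropy_companion.
exact: svm_symmetric_hyperbolic.
Qed.
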